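(* Fix $\mu\in(-1,1)$ and let $\xi$ be such that $u^\xi\in\mathcal M_\mu$. Let $v\in H^1(0,1)$ with $\int_0^1v\,dx=0$ and $\langle v,u^\xi_i\rangle=0$ for $i=1,\dots,N$. Then $$\langle\mathcal L^\xi v,v\rangle\le\big(-\lambda_0\varepsilon+\mathcal O(\exp)\big)\|v\|^2 .$$
   Context: $0<\varepsilon\ll1$; $f(u)=u^3-u$; $\langle\cdot,\cdot\rangle$, $\|\cdot\|$ inner product and norm of $L^2(0,1)$. $U(x)=\tanh(x/\sqrt2)$; $U(x;\xi,\pm1)=\pm U((x-\xi)/\varepsilon)$. Fix an integer $N\ge1$, small $\kappa_0>0$, $\rho_\varepsilon=\varepsilon^{\kappa_0}$. $\Omega_{\rho_\varepsilon}=\{h\in\mathbb R^{N+1}:0<h_1<\dots<h_{N+1}<1,\ \min_{j=0,\dots,N+1}|h_{j+1}-h_j|>\varepsilon/\rho_\varepsilon\}$ with $h_0=-h_1$, $h_{N+2}=2-h_{N+1}$. For $h\in\Omega_{\rho_\varepsilon}$, $u^h=\sum_{j=1}^{N+1}U(\cdot;h_j,(-1)^{j+1})+\beta_N$, where $\beta_N=\frac{(-1)^N-1}{2}+\mathcal O(\exp)$ (also for derivatives) is a correction making $u^h(0)=-1$ and $u^h$ satisfy Neumann boundary conditions; $\mathcal O(\exp)$ means exponentially small in $\varepsilon$. $\mathcal M=\{u^h:h\in\Omega_{\rho_\varepsilon}\}$ and $\mathcal M_\mu=\{u^h\in\mathcal M:\int_0^1u^h=\mu\}$. There is a smooth map $h_{N+1}:[0,1]^N\to\mathbb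 R$ such that $u^h\in\mathcal M_\mu$ iff $h=(\xi,h_{N+1}(\xi))\in\Omega_{\rho_\varepsilon}$ with $\xi=(h_1,\dots,h_N)$; write $u^\xi=u^{(\xi,h_{N+1}(\xi))}$ and $u^\xi_i=\partial_{\xi_i}u^\xi$. $\mathcal L^\xi v=\varepsilon^2v_{xx}-f'(u^\xi)v$. $\lambda_0>0$ is a constant such that every $w\in H^1(\mathbb R)$ with $w(0)=0$ or $\int_{\mathbb R}wU'=0$ satisfies $\int_{\mathbb R}(-w'^2-f'(U)w^2)\le-\lambda_0\|w\|^2_{L^2(\mathbb R)}$. *)

(* Defs.v *)
From HB Require Import structures.
From mathcomp Require Import all_boot all_order all_algebra.
From mathcomp Require Import all_classical all_reals all_analysis.
Set Implicit Arguments.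
Unset Strict Implicit.
Unset Printing Implicit Defensive.
Import Order.TTheory GRing.Theory Num.Theory.
Import numFieldNormedType.Exports.
Local Open Scope classical_set_scope.
Local Open Scope ring_scope.

Section Defs.
Variable R : realType.


Definition f (u : R) : R := u ^+ 3 - u.
Definition f' (u : R) : R := 3 * u ^+ 2 - 1.

Definition tanh (y : R) : R := (expR y - expR (- y)) / (expR y + expR (- y)).

Definition U (x : R) : R := tanh (x / Num.sqrt 2).

Definition L2 (D : set R) (g : R -> R) : Prop :=
  measurable_fun D g /\ lebesgue_measure.-integrable D (fun x => (g x ^+ 2)%:E).

(* v in H^1(0,1) with weak derivative g : v is (a.e. equal to) an absolutely
   continuous function whose derivative is g in L^2(0,1) *)
Definition H1_01 (v g : R -> R) : Prop :=
  L2 `[0, 1] v /\ L2 `[0, 1] g /\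
  forall x, 0 <= x <= 1 -> v x = v 0 + \int[lebesgue_measure]_(y in `[0, x]) g y.

Definition H1R (w g : R -> R) : Prop :=
  L2 setT w /\ L2 setT g /\
  forall a b, a <= b -> w b - w a = \int[lebesgue_measure]_(y in `[a, b]) g y.

Definition ip01 (v w : R -> R) : R := \int[lebesgue_measure]_(x in `[0, 1]) (v x * w x).
Definition nrm2_01 (v : R -> R) : R := ip01 v v.

Definition rho (kappa0 eps : R) : R := eps `^ kappa0.

(* extended positions h_0 = -h_1, h_j (1 <= j <= N+1), h_{N+2} = 2 - h_{N+1};
   h : 'rV_(N+1) stores h_j at index j-1 *)
Definition hext (N : nat) (h : 'rV[R]_N.+1) (j : nat) : R :=
  if j == 0%N then - h ord0 ord0
  else if (j <= N.+1)%N then h ord0 (inord j.-1)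
  else 2 - h ord0 ord_max.

Definition InOmega (N : nat) (kappa0 eps : R) (h : 'rV[R]_N.+1) : Prop :=
  [/\ 0 < hext h 1,
      (forall j, (1 <= j <= N)%N -> hext h j < hext h j.+1),
      hext h N.+1 < 1 &
      (forall j, (j <= N.+1)%N -> eps / rho kappa0 eps < `|hext h j.+1 - hext h j|)].

(* u^h = sum_{j=1}^{N+1} U(.; h_j, (-1)^{j+1}) + beta_N ;
   beta : eps -> h -> x -> R is the correction term *)
Definition uh (N : nat) (beta : R -> 'rV[R]_N.+1 -> R -> R) (eps : R)
  (h : 'rV[R]_N.+1) (x : R) : R :=
  \sum_(j < N.+1) (-1) ^+ j * U ((x - h ord0 j) / eps) + beta eps h x.

Definition hxi (N : nat) (hN1 : 'rV[R]_N -> R) (xi : 'rV[R]_N) : 'rV[R]_N.+1 :=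
  \row_(j < N.+1) match unlift ord_max j with
                  | Some k => xi ord0 k
                  | None => hN1 xi
                  end.

Definition xipart (N : nat) (h : 'rV[R]_N.+1) : 'rV[R]_N :=
  \row_(k < N) h ord0 (lift ord_max k).

Definition uxi N beta eps (hN1 : 'rV[R]_N -> R) (xi : 'rV[R]_N) (x : R) : R :=
  uh beta eps (hxi hN1 xi) x.

Definition uxi_i N beta eps (hN1 : 'rV[R]_N -> R) (xi : 'rV[R]_N) (i : 'I_N)
  (x : R) : R :=
  derive (fun xi' => uxi beta eps hN1 xi' x) xi (delta_mx ord0 i).

(* <L^xi v, v> for v in H^1(0,1) with weak derivative g (Neumann quadratic
   form): -eps^2 int v'^2 - int f'(u^xi) v^2 *)
Definition QL (eps : R) (u : R -> R) (v g : R -> R) : R :=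
  - eps ^+ 2 * \int[lebesgue_measure]_(x in `[0, 1]) (g x ^+ 2)
  - \int[lebesgue_measure]_(x in `[0, 1]) (f' (u x) * v x ^+ 2).

Definition lambda0_prop (lambda0 : R) : Prop :=
  forall w g, H1R w g ->
    (w 0 = 0 \/ \int[lebesgue_measure]_(y in setT) (w y * derive1 U y) = 0) ->
    \int[lebesgue_measure]_(y in setT) (- g y ^+ 2 - f' (U y) * w y ^+ 2)
      <= - lambda0 * \int[lebesgue_measure]_(y in setT) (w y ^+ 2).

End Defs.

(* Main.v *)
Require Import Defs.
From HB Require Import structures.
From mathcomp Require Import all_boot all_order all_algebra.
From mathcomp Require Import all_classical all_reals all_analysis.
From mathcomp Require Import measurable_realfun ring lra.
Import Order.TTheory GRing.Theory Num.Theory.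
Import numFieldNormedType.Exports.
Local Open Scope classical_set_scope.
Local Open Scope ring_scope.

Set Implicit Arguments.
Unset Strict Implicit.
Unset Printing Implicit Defensive.

Local Notation leb := lebesgue_measure.
Local Notation integrable_on a b f := (leb.-integrable `[a, b] (EFin \o f)).

(** Cut [0,1] at the midpoints between consecutive layers.  On the piece around
    [h_j] write [v = al_j X_j + w_j], where [X_j x = sech2 ((x - h_j) / eps)] is
    proportional to [U' ((x - h_j) / eps)] and [al_j = v h_j], so that [w_j] vanishes
    at [h_j].  Completing the square with a suitable Riccati function bounds the
    energy of [v] on the piece below by [2/5 int w_j^2], up to an exponentially small
    multiple of [al_j^2].  Differentiating the mass constraint gives
    [d h_(N+1) / d xi_i = - (-1)^(i+N) + O(exp)] for layers numbered from [0], so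
    orthogonality to the [u_i^xi] says that all the projections [int v X_j] agree up
    to [O(exp)], and the mean-zero condition controls [sum_j al_j] by [int w].
    Together they give [eps int v^2 <= 7/50 int w^2].  A test function shows
    [lambda0 <= 27/10], and [27/10 * 7/50 < 2/5], which leaves room for all the
    exponentially small errors. *)

(** Why the gap is only of order [eps]: each [X_j] is nearly in the kernel of the operator, and the
    orthogonality conditions leave essentially one combination of them free, [sum_j X_j]. Its mean
    is not zero, so [w] has to compensate it, most cheaply by a function spread over all of [0,1]
    with values of size [eps * al]. This costs only [int w^2] of order [eps^2 * al^2], while
    [int v^2] is of order [eps * al^2]. So [eps int v^2] is the right quantity to compare with
    [int w^2], and the numerical constants matter: no power of [eps] is left to absorb a lossy
    factor.

    Two difficulties shape the local estimate. The function [v] has merely a square-integrable weak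
    derivative, so every integration by parts is carried out on integral representations. And [v]
    satisfies no condition at the midpoints, so the boundary terms there are quadratic forms in
    uncontrolled values of [w]; they must have a favourable sign up to a factor [X_j], which is
    exponentially small at the midpoints. The comparison function depends on [|U|] and has a kink at
    the centre of the layer, so each layer is handled as two halves glued where [w] vanishes. *)

Section IntegrableEFin.
Context d (T : measurableType d) (R : realType).
Variable nu : {measure set T -> \bar R}.
Implicit Types (D : set T) (f g : T -> R) (k : R).

Lemma integrableD_EFin D f g :
  measurable D -> nu.-integrable D (EFin \o f) -> nu.-integrable D (EFin \o g) ->
  nu.-integrable D (EFin \o (fun x => f x + g x)).
Proof. by move=> mD fi gi; exact: (eq_integrable mD _ _ (fun _ _ => erefl)
  (integrableD mD fi gi)). Qed.

Lemma integrableB_EFin D f g :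
  measurable D -> nu.-integrable D (EFin \o f) -> nu.-integrable D (EFin \o g) ->
  nu.-integrable D (EFin \o (fun x => f x - g x)).
Proof. by move=> mD fi gi; exact: (eq_integrable mD _ _ (fun _ _ => erefl)
  (integrableB mD fi gi)). Qed.

Lemma integrableZ_EFin D k f :
  measurable D -> nu.-integrable D (EFin \o f) ->
  nu.-integrable D (EFin \o (fun x => k * f x)).
Proof. by move=> mD fi; exact: (eq_integrable mD _ _ (fun _ _ => erefl)
  (integrableZl mD k fi)). Qed.

Lemma integrable_restrict_EFin D f : measurable D ->
  nu.-integrable D (EFin \o f) -> nu.-integrable setT (EFin \o (f \_ D)).
Proof. by move=> mD fi; rewrite -restrict_EFin; apply: (integrable_mkcond _ mD).1. Qed.

End IntegrableEFin.

(** * Absolutely continuous functions *)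

Section AbsolutelyContinuous.
Variable R : realType.
Implicit Types (a b x : R) (F G f g : R -> R).

(** The density [f] is carried along explicitly and need not be a pointwise derivative: this is the
    form in which [H1_01] provides [v], and sums and products are handled as identities between
    densities. *)
Definition abs_cont a b F f :=
  integrable_on a b f /\
  forall x, a <= x <= b -> F x = F a + \int[leb]_(t in `[a, x]) f t.

Lemma integrable_sub a b c d f : a <= c -> d <= b ->
  integrable_on a b f -> integrable_on c d f.
Proof.
move=> ac db; apply: integrableS => // x /=.
rewrite !in_itv/= => /andP[cx xd]; apply/andP; split.
  exact: le_trans cx.
exact: le_trans xd db.
Qed.

Lemma integrable_onD a b f g : integrable_on a b f -> integrable_on a b g ->
  integrable_on a b (fun x => f x + g x).
Proof. by move=> fi gi; exact: integrableD_EFin. Qed.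

Lemma integrable_onB a b f g : integrable_on a b f -> integrable_on a b g ->
  integrable_on a b (fun x => f x - g x).
Proof. by move=> fi gi; exact: integrableB_EFin. Qed.

Lemma integrable_onZ a b k f : integrable_on a b f ->
  integrable_on a b (fun x => k * f x).
Proof. by move=> fi; exact: integrableZ_EFin. Qed.

Lemma integrable_bounded_mul a b (M : R) f g :
  measurable_fun `[a, b] g -> (forall x, a <= x <= b -> `|g x| <= M) ->
  integrable_on a b f -> integrable_on a b (fun x => f x * g x).
Proof.
move=> mg gM fi.
apply: (eq_integrable _ _ _ (fun _ _ => erefl) (integrableMl _ fi mg _)) => //.
exists M; split; first exact: num_real.
move=> y My x /=; rewrite in_itv/= => xab.
by apply: le_trans (gM _ xab) _; exact: ltW.
Qed.

Lemma integrable_bounded a b (M : R) g :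
  measurable_fun `[a, b] g -> (forall x, a <= x <= b -> `|g x| <= M) ->
  integrable_on a b g.
Proof.
move=> mg gM.
apply: measurable_bounded_integrable => //.
  exact/compact_finite_measure/segment_compact.
exists M; split; first exact: num_real.
move=> y My x /=; rewrite in_itv/= => xab.
by apply: le_trans (gM _ xab) _; exact: ltW.
Qed.

Lemma Rintegral_itv_split a b c f : a <= b -> b <= c ->
  integrable_on a c f ->
  \int[leb]_(t in `[a, c]) f t =
  \int[leb]_(t in `[a, b]) f t + \int[leb]_(t in `[b, c]) f t.
Proof.
move=> ab bc fi.
have h : integrable_on b c f by exact: integrable_sub fi.
rewrite -(@Rintegral_itv_obnd_cbnd R b (BRight c)); last first.
  by apply: integrableS h => //; exact: subset_itv_oc_cc.
rewrite -(@Rintegral_itvB R f (BLeft a) (BRight c) b fi) ?bnd_simp//.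
by rewrite addrC subrK.
Qed.

Lemma abs_cont_sub a b c d F f : a <= c -> c <= d -> d <= b ->
  abs_cont a b F f -> abs_cont c d F f.
Proof.
move=> ac cd db [fi Ff]; split; first exact: integrable_sub fi.
move=> x /andP[cx xd].
rewrite Ff; last by rewrite (le_trans ac cx) (le_trans xd db).
rewrite (Ff c); last by rewrite ac (le_trans cd db).
rewrite -addrA -Rintegral_itv_split//.
by apply: integrable_sub fi => //; exact: le_trans db.
Qed.

Lemma abs_cont_eq a b F f g : (forall x, a <= x <= b -> f x = g x) ->
  abs_cont a b F f -> abs_cont a b F g.
Proof.
move=> fg [fi Ff]; split.
  by apply: (eq_integrable _ _ _ _ fi) => // x; rewrite inE/= in_itv/= => /fg ->.
move=> x xab; rewrite Ff//; congr (_ + _); apply: eq_Rintegral => t.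
rewrite inE/= in_itv/= => /andP[at_ tx]; apply: fg; rewrite at_/=.
by apply: le_trans tx _; case/andP: xab.
Qed.

Lemma abs_cont_continuous a b F f : a <= b -> abs_cont a b F f ->
  {within `[a, b], continuous F}.
Proof.
move=> ab [fi Ff].
have c : {within `[a, b], continuous (fun x => F a + \int[leb]_(t in `[a, x]) f t)}.
  move=> x; apply: cvgD; first exact: cvg_cst.
  exact: parameterized_integral_continuous.
apply: (subspace_eq_continuous _ c) => x.
by rewrite inE/= in_itv/= => /Ff /= /esym.
Qed.

Lemma abs_cont_measurable a b F f : a <= b -> abs_cont a b F f ->
  measurable_fun `[a, b] F.
Proof.
move=> ab Ff; apply: subspace_continuous_measurable_fun => //.
exact: abs_cont_continuous Ff.
Qed.

Lemma abs_cont_bounded a b F f : a <= b -> abs_cont a b F f ->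
  exists M, forall x, a <= x <= b -> `|F x| <= M.
Proof.
move=> ab [fi Ff]; exists (`|F a| + \int[leb]_(t in `[a, b]) `|f t|) => x /andP[ax xb].
rewrite Ff ?ax// (le_trans (ler_normD _ _))// lerD2l.
have fx : integrable_on a x f by exact: integrable_sub fi.
apply: le_trans (le_normr_Rintegral _ fx) _ => //.
rewrite (@Rintegral_itv_split a x b)//; last exact: integrable_norm.
by rewrite lerDl; apply: Rintegral_ge0.
Qed.

Lemma abs_cont_integrable a b F f : a <= b -> abs_cont a b F f ->
  integrable_on a b F.
Proof.
move=> ab Ff; have [M FM] := abs_cont_bounded ab Ff.
by apply: integrable_bounded FM; exact: abs_cont_measurable Ff.
Qed.

Lemma abs_cont_mul_integrable a b F f g : a <= b -> abs_cont a b F f ->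
  integrable_on a b g -> integrable_on a b (fun x => g x * F x).
Proof.
move=> ab Ff gi; have [M FM] := abs_cont_bounded ab Ff.
by apply: integrable_bounded_mul FM gi; exact: abs_cont_measurable Ff.
Qed.

Lemma abs_cont_cst a b (k : R) : abs_cont a b (cst k) (cst 0).
Proof.
split; first exact: integrable0.
by move=> x _; rewrite Rintegral_cst// mul0r addr0.
Qed.

Lemma abs_contD a b F G f g : abs_cont a b F f -> abs_cont a b G g ->
  abs_cont a b (fun x => F x + G x) (fun x => f x + g x).
Proof.
move=> [fi Ff] [gi Gg]; split; first exact: integrableD_EFin.
move=> x xab; have /andP[ax xb] := xab.
rewrite Ff// Gg// RintegralD//; last 2 first.
- exact: integrable_sub fi.
- exact: integrable_sub gi.
by rewrite addrACA.
Qed.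

Lemma abs_contZ a b (k : R) F f : abs_cont a b F f ->
  abs_cont a b (fun x => k * F x) (fun x => k * f x).
Proof.
move=> [fi Ff]; split; first exact: integrableZ_EFin.
move=> x xab; have /andP[ax xb] := xab.
rewrite Ff// RintegralZl//; last exact: integrable_sub fi.
by rewrite mulrDr.
Qed.

(* Fubini for [f x * g y] on the triangle [a <= x <= y <= b]. *)
Lemma integral_triangle a b f g : a <= b ->
  integrable_on a b f -> integrable_on a b g ->
  \int[leb]_(x in `[a, b]) (f x * \int[leb]_(y in `[x, b]) g y) =
  \int[leb]_(y in `[a, b]) (g y * \int[leb]_(x in `[a, y]) f x).
Proof.
move=> ab fi gi.
pose f0 := f \_ `[a, b]. pose g0 := g \_ `[a, b].
have mf0 : leb.-integrable setT (EFin \o f0).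
  exact: integrable_restrict_EFin.
have mg0 : leb.-integrable setT (EFin \o g0).
  exact: integrable_restrict_EFin.
have f0m : measurable_fun [set: measurableTypeR R] f0.
  by apply/measurable_EFinP; exact: measurable_int mf0.
have g0m : measurable_fun [set: measurableTypeR R] g0.
  by apply/measurable_EFinP; exact: measurable_int mg0.
pose h := fun z : measurableTypeR R * measurableTypeR R =>
  (f0 z.1 * g0 z.2 * ((z.1 : R) <= z.2)%R%:R)%:E.
have mh : measurable_fun setT h.
  apply/measurable_EFinP; apply: measurable_funM.
    by apply: measurable_funM; exact: measurableT_comp.
  apply: (measurableT_comp (f := fun b : bool => b%:R : R)) => //.
  have m1 : measurable_fun setT (fun z : measurableTypeR R * measurableTypeR R => z.1 : R).
    exact: measurable_fst.
  have m2 : measurable_fun setT (fun z : measurableTypeR R * measurableTypeR R => z.2 : R).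
    exact: measurable_snd.
  exact: measurable_fun_ler.
have inner1 (x : R) : (\int[leb]_y h (x, y) =
    (((fun x => f x * \int[leb]_(y in `[x, b]) g y) \_ `[a, b]) x)%:E)%E.
  rewrite /h /= patchE; case: ifPn => xab; last first.
    under eq_integral do rewrite /f0 patchE (negPf xab) !mul0r.
    by rewrite integral0.
  have /andP[ax xb] : a <= x <= b by move: xab; rewrite inE/= in_itv.
  have gx : integrable_on x b g by exact: integrable_sub gi.
  have gx0 : leb.-integrable setT (EFin \o (g \_ `[x, b])).
    exact: integrable_restrict_EFin.
  rewrite EFinM /Rintegral fineK; last exact: integrable_fin_num.
  rewrite integral_mkcond restrict_EFin -integralZl//.
  apply: eq_integral => y _ /=; rewrite -EFinM; congr EFin.
  rewrite /f0 /g0 !patchE xab -mulrA; congr (_ * _).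
  case: ifPn; rewrite !(inE, notin_setE)/= !in_itv/=.
    move=> /andP[ay yb]; case: (leP x y) => xy.
      by rewrite mulr1 mem_set//= in_itv/= xy yb.
    by rewrite mulr0 memNset//= in_itv/= leNgt xy.
  move=> ayb; rewrite mul0r memNset//= in_itv/= => /andP[xy yb].
  by apply: ayb; rewrite yb (le_trans ax).
have inner2 (y : R) : (\int[leb]_x h (x, y) =
    (((fun y => g y * \int[leb]_(x in `[a, y]) f x) \_ `[a, b]) y)%:E)%E.
  rewrite /h /= patchE; case: ifPn => yab; last first.
    under eq_integral do rewrite /g0 patchE (negPf yab) mulr0 mul0r.
    by rewrite integral0.
  have /andP[ay yb] : a <= y <= b by move: yab; rewrite inE/= in_itv.
  have fy : integrable_on a y f by exact: integrable_sub fi.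
  have fy0 : leb.-integrable setT (EFin \o (f \_ `[a, y])).
    exact: integrable_restrict_EFin.
  rewrite EFinM /Rintegral fineK; last exact: integrable_fin_num.
  rewrite integral_mkcond restrict_EFin -integralZl//.
  apply: eq_integral => x _ /=; rewrite -EFinM; congr EFin.
  rewrite /f0 /g0 !patchE yab mulrAC mulrC; congr (_ * _).
  case: ifPn; rewrite !(inE, notin_setE)/= !in_itv/=.
    move=> /andP[ax xb]; case: (leP x y) => xy.
      by rewrite mulr1 mem_set//= in_itv/= ax.
    by rewrite mulr0 memNset//= in_itv/= (leNgt x) xy andbF.
  move=> axb; rewrite mul0r memNset//= in_itv/= => /andP[ax xy].
  by apply: axb; rewrite ax (le_trans xy).
have mag : measurable_fun [set: measurableTypeR R] (fun y => `|(g0 y)%:E|%E).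
  by apply: measurableT_comp => //; exact/measurable_EFinP.
have maf : measurable_fun [set: measurableTypeR R] (fun x => `|f0 x|%:E).
  by apply/measurable_EFinP; exact: measurableT_comp.
have mabs : measurable_fun setT (abse \o h) by exact: measurableT_comp.
have ih : (leb \x leb)%E.-integrable setT h.
  apply/integrable12ltyP => //.
  have le1 x : (\int[leb]_y `|h (x, y)| <= `|f0 x|%:E * \int[leb]_y `|(g0 y)%:E|)%E.
    rewrite -ge0_integralZl//.
    apply: ge0_le_integral => //.
    - apply: measurableT_comp => //.
      exact: (measurableT_comp mh (pair1_measurable x)).
    - exact: measurable_funeM.
    - move=> y _ /=; rewrite -EFinM lee_fin !normrM -normrM.
      by case: (x <= y); rewrite /= ?normr1 ?normr0 ?mulr1 ?mulr0// normrM.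
  apply: (@le_lt_trans _ _ (\int[leb]_x (`|f0 x|%:E * \int[leb]_y `|(g0 y)%:E|))%E).
    apply: ge0_le_integral => //.
    - by move=> x _; exact: integral_ge0.
    - have H := measurable_fun_fubini_tonelli_F (m2 := leb) (abse \o h) mabs.
      exact: (H (fun z => abse_ge0 (h z))).
    - exact: emeasurable_funM.
  have /integrableP[_ fl] := mf0; have /integrableP[_ gl] := mg0.
  rewrite ge0_integralZr//; last exact: integral_ge0.
  apply: lte_mul_pinfty => //.
  - exact: integral_ge0.
  - by rewrite ge0_fin_numE// integral_ge0.
rewrite Rintegral_mkcond [RHS]Rintegral_mkcond /Rintegral; congr fine.
etransitivity; last first.
  by apply: eq_integral => y _; exact: inner2.
etransitivity; last exact: (Fubini ih).
by apply: eq_integral => x _; exact/esym/inner1.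
Qed.

(* Integrating [f * G] and [g * F] over the square and splitting it along
   the diagonal gives the product rule. *)
Lemma abs_contM a b F G f g : a <= b -> abs_cont a b F f -> abs_cont a b G g ->
  abs_cont a b (fun x => F x * G x) (fun x => f x * G x + g x * F x).
Proof.
move=> ab Ff Gg; have [fi FE] := Ff; have [gi GE] := Gg.
split.
  apply: integrableD_EFin => //.
    exact: (abs_cont_mul_integrable ab Gg).
  exact: (abs_cont_mul_integrable ab Ff).
move=> x /andP[ax xb].
have fx : integrable_on a x f by exact: integrable_sub fi.
have gx : integrable_on a x g by exact: integrable_sub gi.
have Ffx := abs_cont_sub (lexx a) ax xb Ff.
have Ggx := abs_cont_sub (lexx a) ax xb Gg.
have fGi : integrable_on a x (fun t => f t * G t) := abs_cont_mul_integrable ax Ggx fx.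
have gFi : integrable_on a x (fun t => g t * F t) := abs_cont_mul_integrable ax Ffx gx.
rewrite RintegralD//.
have := @integral_triangle a x f g ax fx gx.
rewrite [LHS](_ : _ = \int[leb]_(t in `[a, x]) (G x * f t - f t * G t)); last first.
  apply: eq_Rintegral => t; rewrite inE/= in_itv/= => /andP[at_ tx].
  rewrite (GE x) ?ax// (GE t); last by rewrite at_ (le_trans tx).
  by rewrite (@Rintegral_itv_split a t x)//; ring.
rewrite [RHS](_ : _ = \int[leb]_(t in `[a, x]) (g t * F t - F a * g t)); last first.
  apply: eq_Rintegral => t; rewrite inE/= in_itv/= => /andP[at_ tx].
  by rewrite (FE t) ?at_ ?(le_trans tx)//; ring.
rewrite !RintegralB//; try exact: integrableZ_EFin.
rewrite !RintegralZl// => E.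
have Fx := FE x; have Gx := GE x; rewrite ax xb in Fx Gx.
have {}Fx := Fx isT; have {}Gx := Gx isT.
move: E; set If := \int[leb]_(t in _) f t; set Ig := \int[leb]_(t in _) g t.
rewrite -/If in Fx; rewrite -/Ig in Gx => E.
rewrite -(subrK (F a * Ig) (\int[leb]_(t in `[a, x]) (g t * F t))) -E Fx Gx.
ring.
Qed.

Lemma abs_cont_C1 a b F f : a < b ->
  (forall x, a <= x <= b -> is_derive x 1 F (f x)) ->
  (forall x, a <= x <= b -> {for x, continuous f}) ->
  abs_cont a b F f.
Proof.
move=> ab dF cf.
have wc (c d : R) : a <= c -> d <= b -> {within `[c, d], continuous f}.
  move=> ac db; apply: continuous_in_subspaceT => x.
  rewrite inE/= in_itv/= => /andP[cx xd]; apply: cf.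
  by rewrite (le_trans ac cx) (le_trans xd db).
have dcf x : a <= x <= b -> {for x, continuous F}.
  by move=> /dF h; apply: differentiable_continuous; apply/derivable1_diffP; case: h.
split.
  apply: continuous_compact_integrable; first exact: segment_compact.
  exact: wc.
move=> x /andP[]; rewrite le_eqVlt => /predU1P[<- _|ax xb].
  by rewrite set_itv1 Rintegral_set1 addr0.
rewrite /Rintegral (@continuous_FTC2 _ f F)//=; first by rewrite addrCA subrr addr0.
- exact: wc.
- split.
  + move=> y; rewrite in_itv/= => /andP[ay yx]; have [] // := dF y.
    by rewrite (ltW ay) (le_trans (ltW yx)).
  + by apply: cvg_at_right_filter; apply: dcf; rewrite lexx ltW.
  + by apply: cvg_at_left_filter; apply: dcf; rewrite xb ltW.
- move=> y; rewrite in_itv/= => /andP[ay yx]; rewrite derive1E.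
  have h := dF y; rewrite (ltW ay) (le_trans (ltW yx) xb) in h.
  by have {}h := h isT; rewrite derive_val.
Qed.

End AbsolutelyContinuous.

(** * The profile of a layer *)

Section Profile.
Variable R : realType.
Implicit Types x y M h eps : R.

Local Notation sqrt2 := (Num.sqrt 2 : R).

Lemma sqrt2_gt0 : 0 < sqrt2. Proof. by rewrite sqrtr_gt0. Qed.

Lemma sqr_sqrt2 : sqrt2 ^+ 2 = 2. Proof. by rewrite sqr_sqrtr. Qed.

Lemma sqrt2_bounds : 7 / 5 <= sqrt2 <= 3 / 2.
Proof. by apply/andP; split; have := sqrt2_gt0; have := sqr_sqrt2; nra. Qed.

(* [sech2 x] is [sech^2 (x / sqrt 2) = sqrt 2 * U'(x)]. *)
Definition sech2 (x : R) : R := 1 - U x ^+ 2.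

Lemma sech2E x : sech2 x =
  4 / (expR (x / sqrt2) + expR (- (x / sqrt2))) ^+ 2.
Proof.
rewrite /sech2 /U /tanh expRN; have := expR_gt0 (x / sqrt2).
set e := expR _ => e0.
have e'0 : 0 < e^-1 by rewrite invr_gt0.
have ee : e * e^-1 = 1 by rewrite divff ?gt_eqF.
have s0 : e + e^-1 != 0 by rewrite gt_eqF ?addr_gt0.
field.
by rewrite gt_eqF//= -expr2 gt_eqF// ltr_pwDl// exprn_gt0.
Qed.

Lemma sech2_gt0 x : 0 < sech2 x.
Proof.
by rewrite sech2E divr_gt0// exprn_gt0// addr_gt0// expR_gt0.
Qed.

Lemma U_bounds x : -1 < U x < 1.
Proof. by apply/andP; split; have := sech2_gt0 x; rewrite /sech2; nra. Qed.

Lemma U0 : U (0 : R) = 0.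
Proof. by rewrite /U /tanh mul0r oppr0 subrr mul0r. Qed.

Lemma U_ge0 x : 0 <= x -> 0 <= U x.
Proof.
move=> x0; rewrite /U /tanh; apply: divr_ge0; last by rewrite addr_ge0 ?expR_ge0.
rewrite subr_ge0 ler_expR.
have : 0 <= x / sqrt2 by rewrite divr_ge0// ltW// sqrt2_gt0.
by lra.
Qed.

Lemma U_opp x : U (- x) = - U x.
Proof. by rewrite /U /tanh mulNr opprK [X in _ / X = _]addrC -[in RHS]mulNr opprB. Qed.

Lemma U_le0 x : x <= 0 -> U x <= 0.
Proof. by move=> x0; rewrite -(opprK x) U_opp oppr_le0 U_ge0// oppr_ge0. Qed.

Lemma sech2_le M x : M <= `|x| -> sech2 x <= 4 * expR (- M).
Proof.
move=> Mx; wlog x0 : x Mx / 0 <= x.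
  move=> H; case: (leP 0 x) => [|/ltW] x0; first exact: H.
  have := H (- x); rewrite normrN /sech2 U_opp sqrrN; apply => //.
  by rewrite oppr_ge0.
rewrite ger0_norm// in Mx; rewrite sech2E ler_pM2l//.
rewrite [expR (- M)]expRN lef_pV2 ?posrE ?expR_gt0 ?exprn_gt0 ?addr_gt0 ?expR_gt0//.
apply: (@le_trans _ _ (expR (x / sqrt2) ^+ 2)); last first.
  by rewrite lerXn2r ?nnegrE ?addr_ge0 ?expR_ge0// lerDl expR_ge0.
rewrite -expRM_natl ler_expR; apply: le_trans Mx _.
rewrite mulrA ler_pdivlMr ?sqrt2_gt0//.
by have /andP[] := sqrt2_bounds; nra.
Qed.

Lemma is_derive_tanh (y : R) : is_derive y 1 (@tanh R) (1 - tanh y ^+ 2).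
Proof.
have g0 : expR y + expR (- y) != 0 by rewrite gt_eqF// addr_gt0 ?expR_gt0.
rewrite (_ : @tanh R = (fun y => expR y - expR (- y)) \*
    (fun y => (expR y + expR (- y))^-1)); last by [].
have dN : is_derive y 1 (fun y => expR (- y)) (- expR (- y)).
  by apply: is_derive_eq; rewrite mulrN1.
have d1 : is_derive y 1 (fun y => expR y - expR (- y)) (expR y + expR (- y)).
  by apply: is_derive_eq; rewrite ?mulrN1 ?opprK.
have d2 : is_derive y 1 (fun y => expR y + expR (- y)) (expR y - expR (- y)).
  by apply: is_derive_eq; rewrite ?mulrN1.
have d3 := is_deriveV (f := fun y => expR y + expR (- y)) g0 d2.
apply: is_derive_eq.
rewrite /tanh /GRing.scale/=; field.
by rewrite g0.
Qed.

Lemma is_derive_U x : is_derive x 1 (@U R) (sech2 x / sqrt2).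
Proof.
have d1 : is_derive x 1 (fun x => x / sqrt2) (sqrt2^-1).
  by apply: is_derive_eq; rewrite /GRing.scale/=; ring.
have d2 := is_derive_tanh (x / sqrt2).
by apply: is_derive_eq.
Qed.

Lemma is_derive_layer h eps x :
  is_derive x 1 (fun x => U ((x - h) / eps)) (sech2 ((x - h) / eps) / (sqrt2 * eps)).
Proof.
have d1 : is_derive x 1 (fun x => (x - h) / eps) (eps^-1).
  by apply: is_derive_eq; rewrite /GRing.scale/=; ring.
have d2 := is_derive_U ((x - h) / eps).
by apply: is_derive_eq; rewrite /GRing.scale/= invfM; ring.
Qed.

Lemma layer_continuous h eps : continuous (fun x => U ((x - h) / eps)).
Proof.
move=> x; apply: differentiable_continuous; apply/derivable1_diffP.
by have [] := is_derive_layer h eps x.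
Qed.

Lemma sech2_layer_continuous h eps : continuous (fun x => sech2 ((x - h) / eps)).
Proof.
move=> x; rewrite /sech2; apply: cvgB; first exact: cvg_cst.
rewrite /GRing.exp/=; apply: cvgM; exact: layer_continuous.
Qed.

End Profile.

(** * The energy around a single layer *)

Section Layer.
Variable R : realType.
Implicit Types (h eps x s : R).

Local Notation sqrt2 := (Num.sqrt 2 : R).

Lemma abs_cont_ext (a b : R) (F G f g : R -> R) : F =1 G ->
  (forall x, a <= x <= b -> f x = g x) -> abs_cont a b F f -> abs_cont a b G g.
Proof. by move=> /funext <-; exact: abs_cont_eq. Qed.

(* With [t = |U|] and [X = 1 - t^2], the function [phi = 7/10 X / (t + 1/50)]
   is nonnegative and bounded, and this is [2 f'(U) - 4/5 - (e phi' + phi^2)],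
   where [e = sqrt 2 * eps]. *)
Lemma riccati_gap (t : R) : 0 <= t <= 1 ->
  0 <= 2 * (3 * t ^+ 2 - 1) - 8 / 10 + 14 / 10 * t * (1 - t ^+ 2) / (t + 1 / 50)
    + 21 / 100 * ((1 - t ^+ 2) / (t + 1 / 50)) ^+ 2.
Proof.
move=> /andP[t0 t1].
have d0 : 0 < t + 1 / 50 by lra.
rewrite (_ : _ + _ = ((2 * (3 * t ^+ 2 - 1) - 8 / 10) * (t + 1 / 50) ^+ 2
   + 14 / 10 * t * (1 - t ^+ 2) * (t + 1 / 50) + 21 / 100 * (1 - t ^+ 2) ^+ 2)
   / (t + 1 / 50) ^+ 2); last by field; rewrite gt_eqF//; lra.
apply: divr_ge0; last by rewrite exprn_ge0// ltW.
(* The quartic numerator attains its small positive minimum on [0,1] close to [t = 43/100]. Both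
   certificates [h1] and [h2] vanish exactly there, as [1849/10000 = (43/100)^2]. *)
have h1 := sqr_ge0 (t ^+ 2 - 1849 / 10000).
have h2 : 0 <= (t - 43 / 100) ^+ 2 * (t + 86 / 100).
  by rewrite mulr_ge0 ?sqr_ge0//; lra.
have h3 : t ^+ 2 <= t by nra.
lra.
Qed.

Section HalfLayer.
Variables (h eps s a b al : R) (v g : R -> R).
Hypotheses (eps0 : 0 < eps) (ab : a < b) (s1 : s = 1 \/ s = -1).
Hypothesis sgnT : forall x, a <= x <= b -> 0 <= s * U ((x - h) / eps).
Hypothesis vg : abs_cont a b v g.
Hypothesis g2 : integrable_on a b (fun x => g x ^+ 2).

Let T x := U ((x - h) / eps).
Let X x := sech2 ((x - h) / eps).
Let e := sqrt2 * eps.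
Let w x := v x - al * X x.
Let iq x := (s * T x + 1 / 50)^-1.
(** This is [e] times the logarithmic derivative of [(|T| + 1/50)^(7/10)]. A pure power of [|T|],
    natural for functions vanishing at [h], would produce a pole there; the shift by [1/50] keeps
    [phi] bounded. *)
Let phi x := s * (7 / 10) * X x * iq x.

(* [2 eps^2 g^2 + 2 f'(T) v^2 - 4/5 w^2] exceeds the derivative of this function by
   [(Z - phi w)^2] and the multiple of [w^2] shown nonnegative in [riccati_gap]. *)
Definition layer_potential x :=
  e * (- 2 * al ^+ 2 * T x * X x ^+ 2 - 4 * al * T x * X x * w x + phi x * w x ^+ 2).

(** The density of [layer_potential], computed from [e T' = X] and [e X' = - 2 T X]; here [Z] is [e]
    times the density of [w]. *)
Let D x := let Z := e * g x + 2 * al * T x * X x in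
  - 2 * al ^+ 2 * (X x ^+ 3 - 4 * T x ^+ 2 * X x ^+ 2)
  - 4 * al * ((X x ^+ 2 - 2 * T x ^+ 2 * X x) * w x + T x * X x * Z)
  + 7 / 10 * (- 2 * s * T x * X x * iq x - (X x * iq x) ^+ 2) * w x ^+ 2
  + 2 * phi x * w x * Z.

Let e_gt0 : 0 < e. Proof. by rewrite mulr_gt0// sqrt2_gt0. Qed.

Let ss : s * s = 1. Proof. by case: s1 => ->; rewrite ?mulr1 ?mulrNN ?mulr1. Qed.

Let q_gt0 x : a <= x <= b -> 0 < s * T x + 1 / 50.
Proof. by move=> /sgnT; rewrite -/(T x) => h0; lra. Qed.

Let acT : abs_cont a b T (fun x => X x / e).
Proof.
apply: (abs_cont_C1 ab) => x xab; first exact: is_derive_layer.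
by apply: cvgM; [exact: sech2_layer_continuous|exact: cvg_cst].
Qed.

Let acX : abs_cont a b X (fun x => - 2 * T x * X x / e).
Proof.
have H := abs_contD (abs_cont_cst a b 1) (abs_contZ (-1) (abs_contM (ltW ab) acT acT)).
apply: abs_cont_ext H => x; first by rewrite /X /sech2 /T /=; ring.
by move=> _ /=; ring.
Qed.

Let aciq : abs_cont a b iq (fun x => - s * X x / e * iq x ^+ 2).
Proof.
apply: (abs_cont_C1 ab) => x xab.
  have d : is_derive x 1 T (X x / e) by exact: is_derive_layer.
  have d1 : is_derive x 1 (fun x => s * T x + 1 / 50) (s * (X x / e)).
    move: T d => T' d.
    by apply: is_derive_eq; rewrite /GRing.scale/=; ring.
  have q0 : s * T x + 1 / 50 != 0 by rewrite gt_eqF// q_gt0.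
  have d2 := is_deriveV (f := fun x => s * T x + 1 / 50) q0 d1.
  by apply: is_derive_eq; rewrite /iq /GRing.scale/= -exprVn; ring.
have q0 : s * T x + 1 / 50 != 0 by rewrite gt_eqF// q_gt0.
have cT : {for x, continuous (fun x => s * T x + 1 / 50)}.
  apply: cvgD; last exact: cvg_cst.
  by apply: cvgM; [exact: cvg_cst|exact: layer_continuous].
have ciq : {for x, continuous iq} by exact: cvgV.
apply: cvgM; last by apply: cvgM.
apply: cvgM; last exact: cvg_cst.
by apply: cvgM; [exact: cvg_cst|exact: sech2_layer_continuous].
Qed.

Let acw : abs_cont a b w (fun x => g x + 2 * al * T x * X x / e).
Proof.
have H := abs_contD vg (abs_contZ (- al) acX).
by apply: abs_cont_ext H => x; rewrite /w/= => *; ring.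
Qed.

Let acF : abs_cont a b layer_potential D.
Proof.
have ab' := ltW ab.
have acTX := abs_contM ab' acT acX.
have H1 := abs_contZ (- 2 * al ^+ 2) (abs_contM ab' acTX acX).
have H2 := abs_contZ (- 4 * al) (abs_contM ab' acTX acw).
have H3 := abs_contZ (s * (7 / 10)) (abs_contM ab' (abs_contM ab' acX aciq)
             (abs_contM ab' acw acw)).
have H := abs_contZ e (abs_contD H1 (abs_contD H2 H3)).
apply: abs_cont_ext H => x.
  by rewrite /layer_potential /phi /=; ring.
move=> xab; rewrite /D /phi /=.
have e0 : e != 0 by rewrite gt_eqF.
have -> : (X x * iq x) ^+ 2 = s * s * (X x * iq x) ^+ 2 by rewrite ss mul1r.
by field.
Qed.

(** Because [X] solves the linearised equation, the terms in [al^2] and in [al * w] of the energy of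
    [v = w + al X] are exact derivatives, namely of the first two terms of [layer_potential]. Only
    the energy of [w] needs the Riccati function. Since [e^2 = 2 eps^2], the integrand is twice the
    energy density minus twice [4/10 w^2]. *)
Lemma layer_half_ge :
  layer_potential b - layer_potential a <=
  \int[leb]_(x in `[a, b]) (e ^+ 2 * g x ^+ 2 + 2 * f' (T x) * v x ^+ 2
                           - 8 / 10 * w x ^+ 2).
Proof.
have ab' := ltW ab; have [Di DE] := acF.
rewrite (DE b); last by rewrite ab' lexx.
rewrite addrAC subrr add0r.
have acv2 := abs_contM ab' vg vg.
have ig : integrable_on a b (fun x => 2 * f' (T x) * v x ^+ 2).
  have acf := abs_contD (abs_contZ 6 (abs_contM ab' acT acT)) (abs_cont_cst a b (-2)).
  apply: (eq_integrable _ _ _ _ (abs_cont_integrable ab' (abs_contM ab' acf acv2))) => //.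
  by move=> x _ /=; congr EFin; rewrite /f' /=; ring.
have iw : integrable_on a b (fun x => 8 / 10 * w x ^+ 2).
  apply: integrableZ_EFin => //.
  exact: (abs_cont_integrable ab' (abs_contM ab' acw acw)).
apply: le_Rintegral => //.
  apply: integrableB_EFin => //; apply: integrableD_EFin => //.
  exact: integrableZ_EFin.
move=> x /=; rewrite in_itv/= => xab.
rewrite /D -subr_ge0 /=.
have q0 := q_gt0 xab.
have /andP[T1 T2] := U_bounds ((x - h) / eps); rewrite -/(T x) in T1 T2.
have tP : 0 <= s * T x <= 1.
  by rewrite sgnT// /=; case: s1 => ->; lra.
have gap := riccati_gap tP.
have TT : (s * T x) ^+ 2 = T x ^+ 2 by rewrite exprMn expr2 ss mul1r.
rewrite TT in gap.
have XE : X x = 1 - T x ^+ 2 by [].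
set Z := e * g x + _.
pose C := 2 * (3 * T x ^+ 2 - 1) - 8 / 10 + 14 / 10 * (s * T x) * X x * iq x
    + 21 / 100 * (X x * iq x) ^+ 2.
have C0 : 0 <= C by move: gap; rewrite /C /iq XE.
rewrite (_ : _ - _ = (Z - phi x * w x) ^+ 2 + C * w x ^+ 2).
  by rewrite addr_ge0 ?sqr_ge0// mulr_ge0// sqr_ge0.
have egE : e * g x = Z - 2 * al * T x * X x by rewrite /Z; ring.
have vE : v x = w x + al * X x by rewrite /w; ring.
have -> : e ^+ 2 * g x ^+ 2 = (Z - 2 * al * T x * X x) ^+ 2 by rewrite -egE; ring.
rewrite {1}vE /phi /C /f'.
rewrite (_ : (Z - s * (7 / 10) * X x * iq x * w x) ^+ 2 =
   Z ^+ 2 - 2 * (s * (7 / 10) * X x * iq x * w x) * Z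
   + s * s * (7 / 10 * X x * iq x * w x) ^+ 2); last by ring.
rewrite ss; generalize (iq x) (w x) Z => i W Z'; rewrite XE.
by field.
Qed.

(** The value of [w] at an endpoint is not controlled, but [s * phi] is positive, so the square in
    [w] absorbs the cross term. As the cross term carries a factor [X] and so does [phi], what
    remains still has a factor [X]. The sign [s] makes one statement serve the left and the right
    endpoint. *)
Lemma layer_potential_ge x : a <= x <= b ->
  - 8 * e * al ^+ 2 * X x <= s * layer_potential x.
Proof.
move=> xab; have q0 := q_gt0 xab.
have /andP[T1 T2] := U_bounds ((x - h) / eps); rewrite -/(T x) in T1 T2.
have t0 : 0 <= s * T x by exact: sgnT.
have t1 : s * T x <= 1 by case: s1 => ->; lra.
have X0 : 0 < X x by exact: sech2_gt0.
have X1 : X x <= 1 by rewrite /X /sech2 -/(T x); nra.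
pose t := s * T x.
have sF : s * layer_potential x = e * X x * (7 / 10 * iq x *
   (w x - 20 / 7 * al * t * (t + 1 / 50)) ^+ 2
   - 2 * al ^+ 2 * t * X x - 40 / 7 * al ^+ 2 * t ^+ 2 * (t + 1 / 50)).
  rewrite /layer_potential /phi /iq.
  have -> : s * (e * (- 2 * al ^+ 2 * T x * X x ^+ 2 - 4 * al * T x * X x * w x +
     s * (7 / 10) * X x / (s * T x + 1 / 50) * w x ^+ 2)) =
     e * (- 2 * al ^+ 2 * t * X x ^+ 2 - 4 * al * t * X x * w x +
     s * s * (7 / 10 * X x / (s * T x + 1 / 50) * w x ^+ 2)) by rewrite /t; ring.
  rewrite ss -/t; field.
  by rewrite /t gt_eqF//; lra.
rewrite sF (_ : - 8 * e * al ^+ 2 * X x = e * X x * (- 8 * al ^+ 2)); last by ring.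
rewrite ler_pM2l ?mulr_gt0//.
have i0 : 0 <= 7 / 10 * iq x * (w x - 20 / 7 * al * t * (t + 1 / 50)) ^+ 2.
  by rewrite mulr_ge0 ?sqr_ge0// mulr_ge0// invr_ge0 ltW.
rewrite -/t in t0 t1.
have A0 : 0 <= al ^+ 2 by exact: sqr_ge0.
have h1 : t * X x <= 1 by nra.
have h2 : t ^+ 2 * (t + 1 / 50) <= 51 / 50 by nra.
have h3 := ler_wpM2l A0 h1; have h4 := ler_wpM2l A0 h2.
lra.
Qed.

End HalfLayer.

End Layer.

(** * The energy of a full layer, exponential smallness, and the size of [lambda0] *)

Section LayerBounds.
Variable R : realType.
Implicit Types (h eps x l r : R) (F v g : R -> R).

Local Notation sqrt2 := (Num.sqrt 2 : R).

Lemma is_derive_continuous F x (d : R) : is_derive x 1 F d -> {for x, continuous F}.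
Proof. by case=> dF _; apply: differentiable_continuous; apply/derivable1_diffP. Qed.

Lemma abs_cont_U l r h eps : l < r -> abs_cont l r (fun x => U ((x - h) / eps))
  (fun x => sech2 ((x - h) / eps) / (sqrt2 * eps)).
Proof.
move=> lr; apply: (abs_cont_C1 lr) => x xab; first exact: is_derive_layer.
by apply: cvgM; [exact: sech2_layer_continuous|exact: cvg_cst].
Qed.

Lemma abs_cont_sech2 l r h eps : l < r -> exists X',
  abs_cont l r (fun x => sech2 ((x - h) / eps)) X'.
Proof.
move=> lr; have acU := abs_cont_U h eps lr.
have H := abs_contD (abs_cont_cst l r 1) (abs_contZ (-1) (abs_contM (ltW lr) acU acU)).
eexists; apply: abs_cont_ext H => // x.
by rewrite /sech2 /=; ring.
Qed.

Lemma integrable_f'U_sqr l r h eps v g : l < r -> abs_cont l r v g ->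
  integrable_on l r (fun x => f' (U ((x - h) / eps)) * v x ^+ 2).
Proof.
move=> lr vg; have lr' := ltW lr; have acU := abs_cont_U h eps lr.
have acf := abs_contD (abs_contZ 3 (abs_contM lr' acU acU)) (abs_cont_cst l r (-1)).
have H := abs_cont_integrable lr' (abs_contM lr' acf (abs_contM lr' vg vg)).
by apply: (eq_integrable _ _ _ _ H) => // x _ /=; congr EFin.
Qed.

Lemma integrable_layer_rest l r h eps (al : R) v g : l < r -> abs_cont l r v g ->
  integrable_on l r (fun x => (v x - al * sech2 ((x - h) / eps)) ^+ 2).
Proof.
move=> lr vg; have lr' := ltW lr; have [X' acX] := abs_cont_sech2 h eps lr.
have acw := abs_contD vg (abs_contZ (- al) acX).
have H := abs_cont_integrable lr' (abs_contM lr' acw acw).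
by apply: (eq_integrable _ _ _ _ H) => // x _ /=; congr EFin; ring.
Qed.

(** The two halves are added and divided by two. At the centre [U] and [w] both vanish, so no
    boundary term appears there; at the ends [8 * sqrt 2 / 2] is rounded up to 6 by
    [sqrt 2 <= 3/2]. *)
Lemma layer_ge l h r eps v g : 0 < eps -> l < h -> h < r ->
  abs_cont l r v g -> integrable_on l r (fun x => g x ^+ 2) ->
  - 6 * eps * v h ^+ 2 * (sech2 ((l - h) / eps) + sech2 ((r - h) / eps)) <=
  \int[leb]_(x in `[l, r]) (eps ^+ 2 * g x ^+ 2
    + f' (U ((x - h) / eps)) * v x ^+ 2
    - 4 / 10 * (v x - v h * sech2 ((x - h) / eps)) ^+ 2).
Proof.
move=> e0 lh hr vg g2.
have lh' := ltW lh; have hr' := ltW hr.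
have vgl := abs_cont_sub (lexx l) lh' hr' vg.
have vgr := abs_cont_sub lh' hr' (lexx r) vg.
have g2l := integrable_sub (lexx l) hr' g2.
have g2r := integrable_sub lh' (lexx r) g2.
have sgnl x : l <= x <= h -> 0 <= -1 * U ((x - h) / eps).
  move=> /andP[_ xh]; rewrite mulN1r oppr_ge0 U_le0// pmulr_lle0 ?invr_gt0//.
  by rewrite subr_le0.
have sgnr x : h <= x <= r -> 0 <= 1 * U ((x - h) / eps).
  by move=> /andP[hx _]; rewrite mul1r U_ge0// divr_ge0 ?subr_ge0// ltW.
have I1 := layer_half_ge (v h) e0 lh (or_intror erefl) sgnl vgl g2l.
have I2 := layer_half_ge (v h) e0 hr (or_introl erefl) sgnr vgr g2r.
have B1 := layer_potential_ge (v h) v e0 (or_intror erefl) sgnl (x := l).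
have B2 := layer_potential_ge (v h) v e0 (or_introl erefl) sgnr (x := r).
rewrite lexx lh' in B1; rewrite lexx hr' in B2.
have {}B1 := B1 isT; have {}B2 := B2 isT.
have z s : layer_potential h eps s (v h) v h = 0.
  rewrite /layer_potential subrr mul0r /sech2 U0; ring.
rewrite z in I1; rewrite z in I2.
set G := fun x => (sqrt2 * eps) ^+ 2 * g x ^+ 2 + 2 * f' (U ((x - h) / eps)) * v x ^+ 2 -
  8 / 10 * (v x - v h * sech2 ((x - h) / eps)) ^+ 2.
have Gi : integrable_on l r G.
  have lr := ltW (lt_trans lh hr).
  apply: integrableB_EFin => //; last first.
    by apply: integrableZ_EFin => //; apply: integrable_layer_rest vg; exact: lt_trans hr.
  apply: integrableD_EFin => //; first exact: integrableZ_EFin.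
  have H := integrable_f'U_sqr h eps (lt_trans lh hr) vg.
  have := integrable_onZ 2 H.
  by under [X in EFin \o X]eq_fun do rewrite mulrA.
have -> : \int[leb]_(x in `[l, r]) (eps ^+ 2 * g x ^+ 2
    + f' (U ((x - h) / eps)) * v x ^+ 2
    - 4 / 10 * (v x - v h * sech2 ((x - h) / eps)) ^+ 2) =
  2^-1 * \int[leb]_(x in `[l, r]) G x.
  rewrite -RintegralZl//; apply: eq_Rintegral => x _.
  by rewrite /G exprMn sqr_sqrt2; field.
rewrite (Rintegral_itv_split lh' hr' Gi).
have /andP[_ s15] := sqrt2_bounds R.
have A0 : 0 <= eps * v h ^+ 2 * (sech2 ((l - h) / eps) + sech2 ((r - h) / eps)).
  apply: mulr_ge0; first by rewrite mulr_ge0 ?sqr_ge0// ltW.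
  by rewrite addr_ge0// ltW// sech2_gt0.
rewrite -/G in I1 I2.
have := ler_wpM2r A0 s15.
lra.
Qed.

Lemma expR_ge_pow (n : nat) (y : R) : 0 <= y -> (0 < n)%N -> (y / n%:R) ^+ n <= expR y.
Proof.
move=> y0 n0; have n0' : (n%:R : R) != 0 by rewrite pnatr_eq0 -lt0n.
have -> : expR y = expR (y / n%:R) ^+ n.
  by rewrite -expRM_natl mulrC divfK.
rewrite lerXn2r ?nnegrE ?expR_ge0 ?divr_ge0//.
by apply: le_trans (expR_ge1Dx _); rewrite lerDr.
Qed.

(** With [rho = eps^kappa], the bound [exp y >= (y/n)^n] makes the left side at most a constant
    times [eps^(kappa n)]. Choosing [kappa n >= k + 1] leaves one spare power of [eps] to absorb the
    constant. *)
Lemma exp_small (kappa c K : R) (k : nat) : 0 < kappa -> 0 < c -> 0 < K ->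
  exists2 e1 : R, 0 < e1 & forall eps, 0 < eps < e1 ->
    K * expR (- c / rho kappa eps) <= eps ^+ k.
Proof.
move=> k0 c0 K0.
pose n := (Num.truncn (k.+1%:R / kappa)).+1.
have nk : k.+1%:R <= kappa * n%:R.
  rewrite mulrC -ler_pdivrMr//; apply/ltW/truncnS_gt.
pose M := K * (n%:R / c) ^+ n.
have M0 : 0 < M by rewrite mulr_gt0// exprn_gt0// divr_gt0.
exists (Num.min 1 M^-1); first by rewrite lt_min ltr01 invr_gt0.
move=> eps /andP[e0]; rewrite lt_min => /andP[e1 eM].
have r0 : 0 < rho kappa eps by exact: powR_gt0.
have y0 : 0 < c / rho kappa eps by rewrite divr_gt0.
rewrite mulNr expRN.
have H1 : (c / rho kappa eps / n%:R) ^+ n <= expR (c / rho kappa eps).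
  by apply: expR_ge_pow => //; exact: ltW.
have p0 : 0 < (c / rho kappa eps / n%:R) ^+ n by rewrite exprn_gt0// divr_gt0.
have H2 : (expR (c / rho kappa eps))^-1 <= ((c / rho kappa eps / n%:R) ^+ n)^-1.
  by rewrite lef_pV2 ?posrE ?expR_gt0.
have rn : rho kappa eps ^+ n <= eps ^+ k.+1.
  rewrite -(powR_mulrn n (ltW r0)) -(powR_mulrn k.+1 (ltW e0)) /rho -powRrM.
  by apply: (ger_powR _ nk); rewrite e0 ltW.
have H3 : K * ((c / rho kappa eps / n%:R) ^+ n)^-1 = M * rho kappa eps ^+ n.
  rewrite /M -(mulrA K) -[in RHS]exprMn -exprVn !invfM !invrK; congr (K * _ ^+ _).
  by ring.
apply: le_trans (ler_wpM2l (ltW K0) H2) _; rewrite H3.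
apply: le_trans (ler_wpM2l (ltW M0) rn) _.
rewrite exprS mulrA ler_piMl ?exprn_ge0 ?ltW//.
by rewrite -(divff (lt0r_neq0 M0)) ltr_pM2l.
Qed.

(* Test [lambda0_prop] with [y (4 - y)] on [0,4], extended by zero. *)
Lemma lambda0_le (lambda0 : R) : lambda0_prop lambda0 -> lambda0 <= 27 / 10.
Proof.
move=> H; pose q := fun y : R => y * (4 - y); pose q' := fun y : R => 4 - 2 * y.
pose w := q \_ `[0, 4]; pose g := q' \_ `[0, 4].
have C1 (F G : R -> R) : (forall x, is_derive x 1 F (G x)) ->
    (forall x, exists d, is_derive x 1 G d) -> abs_cont 0 4 F G.
  move=> dF dG; have l04 : (0 : R) < 4 by rewrite ltr0n.
  apply: (abs_cont_C1 l04) => x _.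
  by have [d /is_derive_continuous] := dG x.
have dq x : is_derive x 1 q (q' x).
  by apply: is_derive_eq; rewrite /q' /GRing.scale/=; ring.
have dq' x : is_derive x 1 q' (-2).
  by apply: is_derive_eq; rewrite /GRing.scale/=; ring.
have acq : abs_cont 0 4 q q' by apply: C1 => // x; exists (-2).
have le04 : (0 : R) <= 4 by [].
have acq' : abs_cont 0 4 q' (cst (-2)).
  by apply: C1 => // x; exists 0; exact: is_derive_cst.
have iq2 : integrable_on 0 4 (fun x => q x ^+ 2).
  exact: (abs_cont_integrable le04 (abs_contM le04 acq acq)).
have iq'2 : integrable_on 0 4 (fun x => q' x ^+ 2).
  exact: (abs_cont_integrable le04 (abs_contM le04 acq' acq')).
have Iq2 : \int[leb]_(x in `[0, 4]) (q x ^+ 2) = 512 / 15.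
  have [_ E] : abs_cont 0 4 (fun y : R => y ^+ 5 / 5 - 2 * y ^+ 4 + 16 / 3 * y ^+ 3) (fun x => q x ^+ 2).
    apply: C1 => x; first by apply: is_derive_eq; rewrite /q /GRing.scale/=; field.
    by eexists; apply: is_derive_eq.
  have := E 4; rewrite le04 lexx => /(_ isT) /=.
  by set I := \int[leb]_(t in _) _; lra.
have Iq'2 : \int[leb]_(x in `[0, 4]) (q' x ^+ 2) = 64 / 3.
  have [_ E] : abs_cont 0 4 (fun y : R => 16 * y - 8 * y ^+ 2 + 4 / 3 * y ^+ 3) (fun x => q' x ^+ 2).
    apply: C1 => x; first by apply: is_derive_eq; rewrite /q' /GRing.scale/=; field.
    by eexists; apply: is_derive_eq.
  have := E 4; rewrite le04 lexx => /(_ isT) /=.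
  by set I := \int[leb]_(t in _) _; lra.
have sq (F : R -> R) : (fun x => (F \_ `[0, 4]) x ^+ 2) = (fun x => F x ^+ 2) \_ `[0, 4].
  by apply/funext => x; rewrite !patchE; case: ifP; rewrite // expr0n.
have L2r (F G : R -> R) : abs_cont 0 4 F G -> integrable_on 0 4 (fun x => F x ^+ 2) ->
    L2 setT (F \_ `[0, 4]).
  move=> FG F2; split.
    by apply: (measurable_restrictT _ _).1 => //; exact: (abs_cont_measurable le04 FG).
  by rewrite /L2 -[X in _.-integrable _ X]/(EFin \o _) sq; exact: integrable_restrict_EFin.
have W : H1R w g.
  split; first exact: L2r acq iq2.
  split; first exact: L2r acq' iq'2.
  move=> a b ab; rewrite /g -Rintegral_mkcondr.
  have -> : `[a, b]%classic `&` `[0, 4]%classic = `[Num.max a 0, Num.min b 4]%classic.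
    apply/seteqP; split=> x /=; rewrite !in_itv/= ge_max le_min.
      by move=> [/andP[-> ->] /andP[-> ->]].
    by move=> /andP[/andP[-> ->] /andP[-> ->]].
  case: (leP (Num.max a 0) (Num.min b 4)) => cd.
    have [a4 b0] : a <= 4 /\ 0 <= b.
      by move: cd; rewrite ge_max !le_min => /andP[/andP[_ ->] /andP[-> _]].
    have c0 : 0 <= Num.max a 0 by rewrite le_max lexx orbT.
    have d4 : Num.min b 4 <= 4 by rewrite ge_min lexx orbT.
    have [_ E] := abs_cont_sub c0 cd d4 acq.
    rewrite (_ : w b = q (Num.min b 4)); last first.
      rewrite /w patchE; case: ifPn; rewrite !(inE, notin_setE)/= in_itv/= b0/=.
        by move=> b4; rewrite min_l.
      by move=> /negP; rewrite -ltNge => b4; rewrite min_r ?ltW// /q subrr mulr0.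
    rewrite (_ : w a = q (Num.max a 0)); last first.
      rewrite /w patchE; case: ifPn; rewrite !(inE, notin_setE)/= in_itv/= a4 andbT.
        by move=> a0; rewrite max_l.
      by move=> /negP; rewrite -ltNge => a0; rewrite max_r ?ltW// /q mul0r.
    by rewrite E ?cd ?lexx// addrAC subrr add0r.
  rewrite set_itv_ge ?bnd_simp -?ltNge// Rintegral_set0.
  have out x : ~ (0 <= x <= 4) -> w x = 0.
    by move=> nx; rewrite /w patchE memNset//= in_itv.
  have [] : 4 < a \/ b < 0; first last.
  1,2: by move=> ?; rewrite !out ?subrr//; lra.
  by move: cd; rewrite lt_max !gt_min => /orP[/orP[]|/orP[]] ?; [lra|left|right|lra].
have w0 : w 0 = 0 by rewrite /w patchE mem_set/= ?in_itv/= ?lexx// /q mul0r.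
have {H} := H w g W (or_introl w0).
have -> : (fun y => w y ^+ 2) = (fun x => q x ^+ 2) \_ `[0, 4] by exact: sq.
rewrite -Rintegral_mkcond Iq2.
have -> : (fun y => - g y ^+ 2 - f' (U y) * w y ^+ 2) =
    (fun y => - q' y ^+ 2 - f' (U y) * q y ^+ 2) \_ `[0, 4].
  apply/funext => y; rewrite /g /w !patchE; case: ifP => // _.
  by rewrite expr0n/= mulr0 subr0 oppr0.
rewrite -Rintegral_mkcond => H.
(* Replacing [f' (U)] by its upper bound 2 makes the quotient explicit:
   [2 + (64/3) / (512/15) = 21/8]. On an interval of length [L] it would be [2 + 10 / L^2], so
   length 4 is enough to get below [27/10]. *)
have : \int[leb]_(x in `[0, 4]) (- 1 * q' x ^+ 2 - 2 * q x ^+ 2) <=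
       \int[leb]_(y in `[0, 4]) (- q' y ^+ 2 - f' (U y) * q y ^+ 2).
  have i2 : integrable_on 0 4 (fun y => f' (U y) * q y ^+ 2).
    have := integrable_f'U_sqr 0 1 (ltr0n _ 4) acq.
    by under [X in EFin \o X]eq_fun do rewrite subr0 divr1.
  have i1 : integrable_on 0 4 (fun y => - q' y ^+ 2).
    have := integrable_onZ (-1) iq'2.
    by under [X in EFin \o X]eq_fun do rewrite mulN1r.
  apply: le_Rintegral => //.
  - by apply: integrableB_EFin => //; exact: integrableZ_EFin.
  - exact: integrableB_EFin.
  - move=> y _.
    have := mulr_ge0 (ltW (sech2_gt0 y)) (sqr_ge0 (q y)).
    by rewrite /f' /sech2; lra.
rewrite RintegralB//; try exact: integrableZ_EFin.
rewrite !RintegralZl// Iq2 Iq'2.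
lra.
Qed.

End LayerBounds.

(** * Quadratic inequalities and the moments of a layer *)

Section Estimates.
Variable R : realType.
Implicit Types (h eps x l r a b : R) (F v g : R -> R).

Local Notation sqrt2 := (Num.sqrt 2 : R).

Lemma sqr_le_of_quadratic (p q s : R) : (forall t, 0 <= p - 2 * t * q + t ^+ 2 * s) ->
  q ^+ 2 <= p * s.
Proof.
move=> H; case: (ltgtP s 0) => [s0|s0|s0].
(* A negative [s] is contradictory: this [t] is so large that [t^2 s] outweighs [p] and [2 t |q|]
   together, for one of the signs of [t]. *)
- pose t := (1 + `|p| + 2 * `|q|) * (1 + (- s)^-1).
  have i0 : 0 < (- s)^-1 by rewrite invr_gt0 oppr_gt0.
  have si : s * (- s)^-1 = -1 by rewrite invrN mulrN divff// lt_eqF.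
  have := H t; have := H (- t).
  have np := normr_ge0 p; have nq := normr_ge0 q; have := ler_norm p.
  have t1 : 1 + `|p| + 2 * `|q| <= t.
    by rewrite /t ler_peMr ?lerDl ?ltW//; lra.
  have t2 : t * s <= - (1 + `|p| + 2 * `|q|).
    have -> : t * s = (1 + `|p| + 2 * `|q|) * s + (1 + `|p| + 2 * `|q|) * (s * (- s)^-1).
      by rewrite /t; ring.
    rewrite si; nra.
  nra.
- have := H (q / s); have : 0 < s^-1 by rewrite invr_gt0.
  rewrite (_ : _ + _ = (p * s - q ^+ 2) * s^-1); last by field; rewrite gt_eqF.
  by move=> i0; rewrite pmulr_lge0// subr_ge0.
- subst s; rewrite mulr0; case: (eqVneq q 0) => [->|q0]; first by rewrite expr0n.
  have := H ((p + 1) / (2 * q)).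
  rewrite (_ : _ + _ = -1); last by field.
  by lra.
Qed.

Lemma Cauchy_Schwarz a b F v :
  integrable_on a b (fun x => F x ^+ 2) -> integrable_on a b (fun x => v x ^+ 2) ->
  integrable_on a b (fun x => F x * v x) ->
  (\int[leb]_(x in `[a, b]) (F x * v x)) ^+ 2 <=
  \int[leb]_(x in `[a, b]) (F x ^+ 2) * \int[leb]_(x in `[a, b]) (v x ^+ 2).
Proof.
move=> iF iv iFv; apply: sqr_le_of_quadratic => t.
rewrite -!RintegralZl// -RintegralB//; last exact: integrable_onZ.
rewrite -RintegralD//; last 2 first.
- by apply: integrable_onB => //; exact: integrable_onZ.
- exact: integrable_onZ.
apply: Rintegral_ge0 => x _.
by rewrite (_ : _ + _ = (F x - t * v x) ^+ 2) ?sqr_ge0//; ring.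
Qed.

Lemma Rintegral_partition (m : nat -> R) (n : nat) F :
  (forall j, (j < n)%N -> m j <= m j.+1) -> integrable_on (m 0) (m n) F ->
  \int[leb]_(x in `[m 0, m n]) F x = \sum_(j < n) \int[leb]_(x in `[m j, m j.+1]) F x.
Proof.
elim: n => [|n IH] mm Fi; first by rewrite big_ord0 set_itv1 Rintegral_set1.
have m0n : m 0 <= m n.
  elim: {IH Fi} n mm => [|n IH] mm; first exact: lexx.
  apply: (@le_trans _ _ (m n)); last by apply: mm; rewrite ltnS leqnSn.
  by apply: IH => j jn; apply: mm; rewrite ltnW.
have mnS : m n <= m n.+1 by exact: mm.
rewrite big_ord_recr/= -IH//; first exact: Rintegral_itv_split.
- by move=> j jn; apply: mm; rewrite ltnW.
- exact: integrable_sub Fi.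
Qed.

Lemma Rintegral_itv_cst a b (k : R) : a < b ->
  \int[leb]_(x in `[a, b]) k = k * (b - a).
Proof.
move=> ab.
have [_ H] : abs_cont a b (fun x => k * x) (cst k).
  apply: (abs_cont_C1 ab) => x _; last exact: cvg_cst.
  by apply: is_derive_eq; rewrite /GRing.scale/=; ring.
have := H b; rewrite (ltW ab) lexx => /(_ isT) /=.
by set I := Rintegral _ _ _; lra.
Qed.

Lemma sech2_le1 x : sech2 x <= 1.
Proof. by rewrite /sech2 lerBlDr lerDl sqr_ge0. Qed.

(** The cubic is the primitive of [1 - t^2]; up to the factor [sqrt 2 * eps] its increment between
    the end values of [T] is the integral of [X^2]. *)
Lemma cubic_bounds (t : R) : 9 / 10 <= t <= 1 -> 6 / 10 <= t - t ^+ 3 / 3 <= 2 / 3.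
Proof.
move=> /andP[t1 t2].
have h1 : 0 <= t * ((1 - t) * (1 + t)) by rewrite !mulr_ge0//; lra.
have h2 : 0 <= (1 - t) ^+ 2 * (t + 2) by rewrite mulr_ge0 ?sqr_ge0//; lra.
by apply/andP; split; lra.
Qed.

Section OneLayer.
Variables (l h r eps E : R).
Hypotheses (eps0 : 0 < eps) (lh : l < h) (hr : h < r) (E_lt : E <= 1 / 10).
Hypotheses (Xl : sech2 ((l - h) / eps) <= E) (Xr : sech2 ((r - h) / eps) <= E).

Let T x := U ((x - h) / eps).
Let X x := sech2 ((x - h) / eps).
Let lr : l < r. Proof. exact: lt_trans hr. Qed.
Let lr' : l <= r. Proof. exact: ltW. Qed.
Let c0 : 0 < sqrt2 * eps. Proof. by rewrite mulr_gt0// sqrt2_gt0. Qed.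

(** Since [|U| <= 1], one has [|U| >= U^2 = 1 - sech2]; the loss is therefore linear in [E], with no
    square root. *)
Lemma layer_left : -1 <= T l <= - 1 + E.
Proof.
have /andP[u1 u2] := U_bounds ((l - h) / eps).
have s : T l <= 0.
  by rewrite U_le0// pmulr_lle0 ?invr_gt0// subr_le0 ltW.
move: Xl; rewrite /sech2 -/(T l); rewrite -/(T l) in u1 u2; nra.
Qed.

Lemma layer_right : 1 - E <= T r <= 1.
Proof.
have /andP[u1 u2] := U_bounds ((r - h) / eps).
have s : 0 <= T r by rewrite U_ge0// divr_ge0 ?subr_ge0// ltW.
move: Xr; rewrite /sech2 -/(T r); rewrite -/(T r) in u1 u2; nra.
Qed.

Lemma integrable_sech2 : integrable_on l r X.
Proof. by have [X' /(abs_cont_integrable lr')] := abs_cont_sech2 h eps lr. Qed.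

Lemma integrable_sech2_sqr : integrable_on l r (fun x => X x ^+ 2).
Proof.
have [X' aX] := abs_cont_sech2 h eps lr.
exact: (abs_cont_integrable lr' (abs_contM lr' aX aX)).
Qed.

Lemma integral_sech2 : \int[leb]_(x in `[l, r]) X x = sqrt2 * eps * (T r - T l).
Proof.
have [_ H] := abs_cont_U h eps lr; have := H r; rewrite lr' lexx => /(_ isT).
under eq_Rintegral do rewrite mulrC.
rewrite RintegralZl//; last exact: integrable_sech2.
rewrite -/(T r) -/(T l) => ->.
by rewrite addrAC subrr add0r mulrA divff ?mul1r// gt_eqF.
Qed.

Lemma integral_sech2_bounds :
  sqrt2 * eps * (2 - 2 * E) <= \int[leb]_(x in `[l, r]) X x <= sqrt2 * eps * 2.
Proof.
have /andP[a1 a2] := layer_left; have /andP[b1 b2] := layer_right.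
by rewrite integral_sech2 !ler_pM2l//; lra.
Qed.

(** On the whole line the integral is [4 * sqrt 2 / 3 * eps], about [1.89 * eps], which leaves room
    for the truncation on both sides. *)
Lemma integral_sech2_sqr_bounds :
  eps <= \int[leb]_(x in `[l, r]) (X x ^+ 2) <= 2 * eps.
Proof.
have aU := abs_cont_U h eps lr.
have aU2 := abs_contM lr' aU aU.
have aU3 := abs_contM lr' aU2 aU.
have [_ H] := abs_contD aU (abs_contZ (- 3^-1) aU3).
have := H r; rewrite lr' lexx => /(_ isT) /=.
rewrite (_ : \int[leb]_(x in `[l, r]) _ = (sqrt2 * eps)^-1 * \int[leb]_(x in `[l, r]) (X x ^+ 2)); last first.
  rewrite -RintegralZl//; last exact: integrable_sech2_sqr.
  apply: eq_Rintegral => x _; rewrite -/(T x).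
  rewrite (_ : sech2 _ = 1 - T x ^+ 2)// /X (_ : sech2 _ = 1 - T x ^+ 2)//.
  by field; rewrite (lt0r_neq0 eps0) (lt0r_neq0 (sqrt2_gt0 R)).
rewrite -/(T r) -/(T l).
have /andP[a1 a2] := layer_left; have /andP[b1 b2] := layer_right.
have /andP[s1 s2] := sqrt2_bounds R.
set I := \int[leb]_(x in _) _ => HI.
have IE : I = sqrt2 * eps * (T r - T r ^+ 3 / 3 - (T l - T l ^+ 3 / 3)).
  have -> : I = sqrt2 * eps * ((sqrt2 * eps)^-1 * I).
    by rewrite mulrA divff ?mul1r// gt_eqF.
  by congr (_ * _); move: HI; set J := _^-1 * I; lra.
have E1 := E_lt.
have r1 : 6 / 10 <= T r - T r ^+ 3 / 3 <= 2 / 3 by apply: cubic_bounds; lra.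
have l1 : - (2 / 3) <= T l - T l ^+ 3 / 3 <= - (6 / 10).
  have : 6 / 10 <= - T l - (- T l) ^+ 3 / 3 <= 2 / 3 by apply: cubic_bounds; lra.
  lra.
move: r1 l1 IE; set p := _ - _; set q := _ - _; move=> /andP[p1 p2] /andP[q1 q2] ->.
have pq1 : 12 / 10 <= p - q by lra.
have pq2 : p - q <= 4 / 3 by lra.
have e1 : 7 / 5 * eps <= sqrt2 * eps by rewrite ler_pM2r.
have e2 : sqrt2 * eps <= 3 / 2 * eps by rewrite ler_pM2r.
apply/andP; split.
  apply: (@le_trans _ _ (7 / 5 * eps * (12 / 10))); first by lra.
  by apply: ler_pM => //; lra.
apply: (@le_trans _ _ (3 / 2 * eps * (4 / 3))); last by lra.
by apply: ler_pM => //; lra.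
Qed.

End OneLayer.

End Estimates.

(** * Coercivity *)

Lemma sum_ord_cst (R : realType) n (k : R) : \sum_(j < n) k = n%:R * k.
Proof. by rewrite sumr_const card_ord mulr_natl. Qed.

(** * Coercivity as an inequality between finitely many numbers attached to the pieces *)

Section CoerciveSums.
Variable R : realType.
Local Notation sqrt2 := (Num.sqrt 2 : R).
Variables (N : nat) (eps B A V : R) (Vj Wj Iwj Ivwj Tj pj al len : nat -> R).
Hypotheses (N1 : (1 <= N)%N) (eps0 : 0 < eps) (eps_small : eps <= 1 / 100 * (1 / 1000)).
Hypotheses (B0 : 0 <= B) (B_small : N.+1%:R * B <= eps ^+ 2 / 1000).
Let W := \sum_(j < N.+1) Wj j.
Let T := Tj N.
Let c := sqrt2 * eps.
Hypotheses (A_ge0 : 0 <= A) (V_ge0 : 0 <= V) (A_le : A ^+ 2 <= V).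
Hypothesis VE : V = \sum_(j < N.+1) Vj j.
Hypothesis Wj_ge0 : forall j, (j <= N)%N -> 0 <= Wj j.
Hypothesis Vj_split : forall j, (j <= N)%N -> Vj j = Ivwj j + al j * Tj j.
Hypothesis mean : \sum_(j < N.+1) (Iwj j + al j * pj j) = 0.
Hypothesis Iwj_le : forall j, (j <= N)%N -> forall t,
  2 * t * Iwj j <= Wj j + t ^+ 2 * len j.
Hypothesis len1 : \sum_(j < N.+1) len j = 1.
Hypothesis Ivwj_le : forall j, (j <= N)%N -> Ivwj j <= 1 / 100 * Vj j + 25 * Wj j.
Hypothesis Tj_sqr_le : forall j, (j <= N)%N -> Tj j ^+ 2 <= 2 * eps * Vj j.
Hypothesis al_sqr_le : forall j, (j <= N)%N -> eps * al j ^+ 2 <= 2 * (Vj j + Wj j).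
Hypothesis pj_bounds : forall j, (j <= N)%N -> c * (2 - 2 * B) <= pj j <= c * 2.
Hypothesis orth : forall j, (j <= N)%N -> `|Tj j - T| <= B * A.

Let B1 : B <= eps ^+ 2 / 1000.
Proof. by apply: le_trans B_small; rewrite ler_peMl// ler1n. Qed.

Let W_ge0 : 0 <= W.
Proof. by apply: sumr_ge0 => j _; apply: Wj_ge0; rewrite -ltnS. Qed.

(** Cauchy-Schwarz on a single piece only gives [T^2 <= 2 eps Vj] up to errors. All [Tj] nearly
    equal [T] and there are at least two layers, so averaging over the pieces halves the factor;
    without this gain the final constants would not close. *)
Let T_le : T ^+ 2 <= 102 / 100 * (eps * V).
Proof.
have es := eps_small; have e0 := eps0; have b0 := B0.
have V0 := V_ge0; have BB1 := B1.
pose n : R := N.+1%:R.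
have n2 : 2 <= n by rewrite ler_nat.
have Bn : n * B <= eps ^+ 2 / 1000 by [].
have key j : (j <= N)%N -> T ^+ 2 <= 202 / 100 * eps * Vj j + 101 * B ^+ 2 * V.
  move=> jN; have T1 := (Tj_sqr_le jN); have := orth jN.
  set r := Tj j - T => r1.
  have r2 : r ^+ 2 <= B ^+ 2 * V.
    apply: (@le_trans _ _ ((B * A) ^+ 2)).
      by rewrite -[r ^+ 2]real_normK ?num_real// lerXn2r ?nnegrE ?mulr_ge0.
    by rewrite exprMn ler_wpM2l ?sqr_ge0 ?A_le.
  have -> : T = Tj j - r by rewrite /r; ring.
  by have := sqr_ge0 (1 / 10 * Tj j + 10 * r); lra.
have : \sum_(j < N.+1) T ^+ 2 <= \sum_(j < N.+1) (202 / 100 * eps * Vj j + 101 * B ^+ 2 * V).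
  by apply: ler_sum => j _; apply: key; rewrite -ltnS.
rewrite sum_ord_cst big_split/= sum_ord_cst -mulr_sumr -VE => H.
have BB : 101 * B ^+ 2 * V <= 1 / 100 * (eps * V).
  have e2 : eps ^+ 2 <= 1 / 100 * (1 / 1000) * eps by rewrite expr2 ler_wpM2r// ltW.
  have b2 : B * B <= B * 1 by apply: ler_wpM2l => //; lra.
  have : 101 * B ^+ 2 <= 1 / 100 * eps by rewrite expr2; lra.
  by move=> /(ler_wpM2r V_ge0); lra.
have n0 : 0 <= n by lra.
have H1 := ler_wpM2l n0 BB.
have eV : 0 <= eps * V by rewrite mulr_ge0// ltW.
have H2 : n * T ^+ 2 <= 2 * (101 / 100 * (eps * V)) + n * (1 / 100 * (eps * V)) by lra.
have H3 : n * (T ^+ 2 - 1 / 100 * (eps * V)) <= 2 * (101 / 100 * (eps * V)) by lra.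
case: (leP (T ^+ 2 - 1 / 100 * (eps * V)) 0) => T0; first by lra.
have := ler_wpM2r (ltW T0) n2; lra.
Qed.

(* [V] is [sum_j (int v w_j + al_j T_j)], the [T_j] may be replaced by [T], and
   mean zero turns [2 c sum_j al_j] into [- int w]; the rest is Young's inequality. *)
Lemma coercive_sums : eps * (27 / 10 * V) <=
  4 / 10 * W - B * V - 12 * B * \sum_(j < N.+1) (eps * al j ^+ 2).
Proof.
pose n : R := N.+1%:R.
pose Sa := \sum_(j < N.+1) (eps * al j ^+ 2).
pose Iw := \sum_(j < N.+1) Iwj j.
have jle (j : 'I_N.+1) : (j <= N)%N by rewrite -ltnS.
have es := eps_small; have e0 := eps0; have b0 := B0.
have V0 := V_ge0; have W0 := W_ge0; have A2 := A_le.
have Sa0 : 0 <= Sa by apply: sumr_ge0 => j _; rewrite mulr_ge0 ?sqr_ge0// ltW.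
have Sa_le : Sa <= 2 * (V + W).
  rewrite VE /W -big_split/= mulr_sumr; apply: ler_sum => j _.
  exact: (al_sqr_le (jle j)).
have mean' : Iw + \sum_(j < N.+1) al j * pj j = 0 by rewrite -[RHS]mean big_split.
have Iw2 : Iw ^+ 2 <= W.
  have : \sum_(j < N.+1) (2 * Iw * Iwj j) <=
      \sum_(j < N.+1) (Wj j + Iw ^+ 2 * len j).
    by apply: ler_sum => j _; exact: (Iwj_le (jle j)).
  rewrite big_split/= -!mulr_sumr -/Iw -/W len1.
  lra.
(* The large weight 25 on [W] is harmless: this inequality is multiplied by [c], of order [eps],
   before it is used. *)
have VV : V <= 1 / 100 * V + 25 * W + \sum_(j < N.+1) al j * Tj j.
  rewrite {1 2}VE /W !mulr_sumr -!big_split/=; apply: ler_sum => j _.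
  have Ivw := (Ivwj_le (jle j)).
  by rewrite {1}(Vj_split (jle j)); lra.
have /andP[s1 s2] := sqrt2_bounds R.
have c0 : 0 < c by rewrite mulr_gt0// sqrt2_gt0.
have c1 : 7 / 5 * eps <= c by rewrite ler_pM2r.
have c2 : c <= 3 / 2 * eps by rewrite ler_pM2r.
have cross : 2 * c * (\sum_(j < N.+1) al j * Tj j) <=
    - T * Iw + 3 * B * Sa + 3 / 2 * eps * (n * B) * (T ^+ 2 + V).
  have -> : - T * Iw = \sum_(j < N.+1) T * (al j * pj j).
    rewrite -mulr_sumr (_ : \sum_(j < N.+1) al j * pj j = - Iw); first by ring.
    by apply: (addrI Iw); rewrite mean' subrr.
  have -> : 3 / 2 * eps * (n * B) * (T ^+ 2 + V) =
      \sum_(j < N.+1) (3 / 2 * eps * B * (T ^+ 2 + V)).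
    by rewrite sum_ord_cst -/n; ring.
  rewrite !mulr_sumr -!big_split/=; apply: ler_sum => j _.
  have /andP[p1 p2] := (pj_bounds (jle j)).
  have := orth (jle j).
  have -> : Tj j = (Tj j - T) + T by ring.
  move: (Tj j - T) => r; rewrite addrK => r1.
  have na := normr_ge0 (al j); have nT := normr_ge0 T.
  have na2 : `|al j| ^+ 2 = al j ^+ 2 by rewrite real_normK ?num_real.
  have nT2 : `|T| ^+ 2 = T ^+ 2 by rewrite real_normK ?num_real.
  have h1 : al j * r <= B * (1 / 2 * (al j ^+ 2 + V)).
    apply: (le_trans (ler_norm _)); rewrite normrM.
    apply: (@le_trans _ _ (`|al j| * (B * A))); first exact: ler_wpM2l.
    rewrite mulrCA; apply: ler_wpM2l => //; rewrite -na2.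
    by have := sqr_ge0 (`|al j| - A); lra.
  have h2 : al j * T * (2 * c - pj j) <= c * B * (al j ^+ 2 + T ^+ 2).
    apply: (le_trans (ler_norm _)); rewrite !normrM.
    have q0 : 0 <= 2 * c - pj j by lra.
    rewrite (ger0_norm q0).
    apply: (@le_trans _ _ (`|al j| * `|T| * (2 * c * B))).
      by apply: ler_wpM2l; [rewrite mulr_ge0|lra].
    have cB : 0 <= c * B by rewrite mulr_ge0// ltW.
    rewrite -na2 -nT2.
    have : 0 <= c * B * (`|al j| - `|T|) ^+ 2 by rewrite mulr_ge0 ?sqr_ge0.
    lra.
  have h3 := ler_wpM2l (ltW c0) h1.
  have h4 : c * B * (2 * al j ^+ 2 + T ^+ 2 + V) <=
      3 / 2 * eps * B * (2 * al j ^+ 2 + T ^+ 2 + V).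
    apply: ler_wpM2r; last exact: ler_wpM2r.
    by have := sqr_ge0 (al j); have := sqr_ge0 T; lra.
  lra.
have eV : 0 <= eps * V by rewrite mulr_ge0// ltW.
(* The weights balance two demands: [3/2 T^2], about [3/2 eps V], must stay well below
   [2 c V >= 14/5 eps V], while the coefficient of [Iw^2 <= W] should be small. *)
have Tw : - T * Iw <= 3 / 2 * T ^+ 2 + 1 / 6 * Iw ^+ 2.
  by have := sqr_ge0 (3 * T + Iw); lra.
have nB : n * B <= eps ^+ 2 / 1000 by [].
have T2 := T_le.
have e2 : eps ^+ 2 <= 1 / 100 * (1 / 1000) * eps by rewrite expr2 ler_wpM2r// ltW.
have BS : B * Sa <= eps ^+ 2 / 1000 * (2 * (V + W)).
  by apply: ler_pM => //.
have VW : 0 <= V + W by rewrite addr_ge0.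
have e2V := ler_wpM2r V_ge0 e2; have e2W := ler_wpM2r W_ge0 e2.
have eW : eps * W <= 1 / 100 * (1 / 1000) * W by exact: ler_wpM2r.
have TV : T ^+ 2 + V <= 2 * V.
  have : eps * V <= 1 / 100 * (1 / 1000) * V by exact: ler_wpM2r.
  lra.
have rest : 3 / 2 * eps * (n * B) * (T ^+ 2 + V) <= 1 / 100 * (eps * V).
  apply: (@le_trans _ _ (3 / 2 * eps * (eps ^+ 2 / 1000) * (2 * V))).
    apply: ler_pM => //.
    - by rewrite !mulr_ge0// ?ler0n// ltW.
    - by rewrite addr_ge0// sqr_ge0.
    - by apply: ler_wpM2l => //; rewrite mulr_ge0// ltW.
  have : 3 / 2 * (eps ^+ 2 / 1000) * 2 <= 1 / 100 by nra.
  by move=> /(ler_wpM2l eV); lra.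
have h5 := ler_wpM2l (ltW c0) VV.
have h6 := ler_wpM2r V_ge0 c1.
have h7 := ler_wpM2r W_ge0 c2.
have h8 := ler_wpM2r V_ge0 B1.
(* To leading order, [(2 * 7/5 * 99/100 - 3/2 * 102/100) eps V <= W / 6]. The bracket exceeds [6/5],
   and [14/100] includes the small errors. *)
have EV : eps * V <= 14 / 100 * W by lra.
rewrite -/Sa; lra.
Qed.

End CoerciveSums.

(** * The integrals on each piece satisfy the hypotheses of that inequality *)

Section Coercivity.
Variable R : realType.
Local Notation sqrt2 := (Num.sqrt 2 : R).

Variables (N : nat) (eps B : R) (hp m : nat -> R) (v g u : R -> R).
Let A := \int[leb]_(x in `[0, 1]) `|v x|.
Hypotheses (N1 : (1 <= N)%N) (eps0 : 0 < eps) (eps_small : eps <= 1 / 100 * (1 / 1000)).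
Hypotheses (B0 : 0 <= B) (B_small : N.+1%:R * B <= eps ^+ 2 / 1000).
Hypotheses (m0 : m 0 = 0) (mN : m N.+1 = 1).
Hypothesis mh : forall j, (j <= N)%N -> m j < hp j /\ hp j < m j.+1.
Hypothesis Xend : forall j, (j <= N)%N ->
  sech2 ((m j - hp j) / eps) <= B /\ sech2 ((m j.+1 - hp j) / eps) <= B.
Hypothesis vg : abs_cont 0 1 v g.
Hypothesis g2 : integrable_on 0 1 (fun x => g x ^+ 2).
Hypothesis v_mean0 : \int[leb]_(x in `[0, 1]) v x = 0.
Hypothesis orth : forall j, (j <= N)%N ->
  `|\int[leb]_(x in `[m j, m j.+1]) (v x * sech2 ((x - hp j) / eps)) -
    \int[leb]_(x in `[m N, m N.+1]) (v x * sech2 ((x - hp N) / eps))| <= B * A.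
Hypothesis uB : forall j, (j <= N)%N -> forall x, m j <= x <= m j.+1 ->
  f' (U ((x - hp j) / eps)) - B <= f' (u x).
Hypothesis iu : integrable_on 0 1 (fun x => f' (u x) * v x ^+ 2).

Let c := sqrt2 * eps.
Let al j := v (hp j).
Let X j x := sech2 ((x - hp j) / eps).
Let w j x := v x - al j * X j x.
Let Vj j := \int[leb]_(x in `[m j, m j.+1]) (v x ^+ 2).
Let Wj j := \int[leb]_(x in `[m j, m j.+1]) (w j x ^+ 2).
Let Iwj j := \int[leb]_(x in `[m j, m j.+1]) w j x.
Let Ivwj j := \int[leb]_(x in `[m j, m j.+1]) (v x * w j x).
Let Tj j := \int[leb]_(x in `[m j, m j.+1]) (v x * X j x).
Let pj j := \int[leb]_(x in `[m j, m j.+1]) X j x.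
Let V := \int[leb]_(x in `[0, 1]) (v x ^+ 2).

Let le01 : (0 : R) <= 1. Proof. exact: ler01. Qed.

Let B1 : B <= eps ^+ 2 / 1000.
Proof. by apply: le_trans B_small; rewrite ler_peMl// ler1n. Qed.

Let B_lt : B <= 1 / 10.
Proof.
have e1 := eps_small; have h : 0 <= eps * (1 - eps) by apply: mulr_ge0; [exact: ltW|lra].
by apply: le_trans B1 _; lra.
Qed.

Let mS j : (j <= N)%N -> m j < m j.+1.
Proof. by move=> /mh[]; exact: lt_trans. Qed.

Let m_le i j : (i <= j)%N -> (j <= N.+1)%N -> m i <= m j.
Proof.
elim: j => [|j IH]; first by rewrite leqn0 => /eqP ->.
rewrite leq_eqVlt => /predU1P[->//|]; rewrite ltnS => ij jN.
by apply: (le_trans (IH ij (ltnW jN))); exact/ltW/mS.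
Qed.

Let sub_int j F : (j <= N)%N -> integrable_on 0 1 F -> integrable_on (m j) (m j.+1) F.
Proof.
move=> jN; apply: integrable_sub.
  by rewrite -m0 m_le// ltnW.
by rewrite -mN m_le.
Qed.

Let vgj j : (j <= N)%N -> abs_cont (m j) (m j.+1) v g.
Proof.
move=> jN; apply: abs_cont_sub vg.
- by rewrite -m0 m_le// ltnW.
- exact/ltW/mS.
- by rewrite -mN m_le.
Qed.

Let split_sum F : integrable_on 0 1 F ->
  \int[leb]_(x in `[0, 1]) F x = \sum_(j < N.+1) \int[leb]_(x in `[m j, m j.+1]) F x.
Proof.
move=> Fi; have := @Rintegral_partition R m N.+1 F; rewrite m0 mN; apply => //.
by move=> j jN; exact/ltW/mS.
Qed.

Let iv2 : integrable_on 0 1 (fun x => v x ^+ 2).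
Proof. exact: (abs_cont_integrable le01 (abs_contM le01 vg vg)). Qed.

Let VE : V = \sum_(j < N.+1) Vj j. Proof. exact: split_sum. Qed.

Section PerLayer.
Variable j : nat.
Hypothesis jN : (j <= N)%N.

Let mm := mS jN.
Let mm' := ltW mm.
Let acv := vgj jN.

Let acX : exists X', abs_cont (m j) (m j.+1) (X j) X'.
Proof. exact: abs_cont_sech2. Qed.

Let acw : exists w', abs_cont (m j) (m j.+1) (w j) w'.
Proof.
have [X' aX] := acX; have H := abs_contD acv (abs_contZ (- al j) aX).
by eexists; apply: abs_cont_ext H => // x; rewrite /w /= mulNr.
Qed.

Let iM F G : (exists F', abs_cont (m j) (m j.+1) F F') ->
  (exists G', abs_cont (m j) (m j.+1) G G') ->
  integrable_on (m j) (m j.+1) (fun x => F x * G x).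
Proof.
by move=> [F' aF] [G' aG]; exact: (abs_cont_integrable mm' (abs_contM mm' aF aG)).
Qed.

Let acv' : exists v', abs_cont (m j) (m j.+1) v v'. Proof. by exists g. Qed.

Let iv : integrable_on (m j) (m j.+1) v.
Proof. exact: (abs_cont_integrable mm' acv). Qed.

Let iw : integrable_on (m j) (m j.+1) (w j).
Proof. by have [w' aw] := acw; exact: (abs_cont_integrable mm' aw). Qed.

Let iX : integrable_on (m j) (m j.+1) (X j).
Proof. by have [X' aX] := acX; exact: (abs_cont_integrable mm' aX). Qed.

Let X2_bounds := integral_sech2_sqr_bounds eps0 (mh jN).1 (mh jN).2 B_lt
  (Xend jN).1 (Xend jN).2.
Lemma pj_bounds : c * (2 - 2 * B) <= pj j <= c * 2.
Proof.
exact: (integral_sech2_bounds eps0 (mh jN).1 (mh jN).2 (Xend jN).1 (Xend jN).2).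
Qed.

Lemma Vj_ge0 : 0 <= Vj j. Proof. by apply: Rintegral_ge0 => x _; exact: sqr_ge0. Qed.
Lemma Wj_ge0 : 0 <= Wj j. Proof. by apply: Rintegral_ge0 => x _; exact: sqr_ge0. Qed.

Lemma Vj_split : Vj j = Ivwj j + al j * Tj j.
Proof.
rewrite /Ivwj /Tj -RintegralZl//; last exact: iM.
rewrite -RintegralD//; [|exact: iM|exact/integrable_onZ/iM].
by apply: eq_Rintegral => x _; rewrite /w; ring.
Qed.

Lemma mean_split : \int[leb]_(x in `[m j, m j.+1]) v x = Iwj j + al j * pj j.
Proof.
transitivity (\int[leb]_(x in `[m j, m j.+1]) (w j x + al j * X j x)).
  by apply: eq_Rintegral => x _; rewrite /w; ring.
rewrite RintegralD//; last exact: integrable_onZ.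
by rewrite RintegralZl.
Qed.

(** Cauchy-Schwarz with a free parameter: using the same [t] on every piece, the lengths add up to 1
    and no factor [N + 1] is lost. *)
Lemma Iwj_le t : 2 * t * Iwj j <= Wj j + t ^+ 2 * (m j.+1 - m j).
Proof.
have -> : t ^+ 2 * (m j.+1 - m j) = \int[leb]_(x in `[m j, m j.+1]) (t ^+ 2).
  by rewrite Rintegral_itv_cst.
have ic : integrable_on (m j) (m j.+1) (fun=> t ^+ 2).
  exact: (abs_cont_integrable mm' (abs_cont_cst _ _ (t ^+ 2))).
rewrite -RintegralZl// -RintegralD//; last exact: iM.
apply: le_Rintegral => //; first exact: integrable_onZ.
  by apply: integrable_onD => //; exact: iM.
by move=> x _; have := sqr_ge0 (w j x - t); lra.
Qed.

Lemma Ivwj_le : Ivwj j <= 1 / 100 * Vj j + 25 * Wj j.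
Proof.
rewrite -!RintegralZl//; [|exact: iM|exact: iM].
rewrite -RintegralD//; [|exact/integrable_onZ/iM|exact/integrable_onZ/iM].
apply: le_Rintegral => //; first exact: iM.
  by apply: integrable_onD; apply: integrable_onZ; exact: iM.
by move=> x _; have := sqr_ge0 (1 / 10 * v x - 5 * w j x); lra.
Qed.

Lemma Tj_sqr_le : Tj j ^+ 2 <= 2 * eps * Vj j.
Proof.
have H := @Cauchy_Schwarz R (m j) (m j.+1) v (X j) (iM acv' acv') (iM acX acX) (iM acv' acX).
apply: le_trans H _; rewrite mulrC; apply: ler_wpM2r; first exact: Vj_ge0.
by case/andP: X2_bounds.
Qed.

(** A point value of [v] is not controlled by [int v^2]; it becomes so together with [int w^2],
    because [al X = v - w] and the integral of [X^2] is at least [eps]. *)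
Lemma al_sqr_le : eps * al j ^+ 2 <= 2 * (Vj j + Wj j).
Proof.
case/andP: X2_bounds => H _.
apply: (@le_trans _ _ (\int[leb]_(x in `[m j, m j.+1]) (X j x ^+ 2) * al j ^+ 2)).
  by rewrite ler_wpM2r ?sqr_ge0.
rewrite -RintegralZr//; last exact: iM.
rewrite mulrDr -!RintegralZl//; [|exact: iM|exact: iM].
rewrite -RintegralD//; [|exact/integrable_onZ/iM|exact/integrable_onZ/iM].
apply: le_Rintegral => //.
- have := integrable_onZ (al j ^+ 2) (iM acX acX).
  by under [X in EFin \o X]eq_fun do rewrite mulrC.
- by apply: integrable_onD; apply: integrable_onZ; exact: iM.
- by move=> x _; rewrite /w; have := sqr_ge0 (2 * v x - al j * X j x); lra.
Qed.

(** The term [B Vj] pays for replacing the single profile by [u] inside [f']; the 12 is the 6 of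
    [layer_ge] counted at both ends of the piece. *)
Lemma layer_energy_ge : 4 / 10 * Wj j - B * Vj j - 12 * B * (eps * al j ^+ 2) <=
  \int[leb]_(x in `[m j, m j.+1]) (eps ^+ 2 * g x ^+ 2 + f' (u x) * v x ^+ 2).
Proof.
have g2j := sub_int jN g2; have iuj := sub_int jN iu.
have ifT := integrable_f'U_sqr (hp j) eps mm acv.
have H := layer_ge eps0 (mh jN).1 (mh jN).2 acv g2j.
have [X1 X2] := Xend jN.
have e1 : 0 <= eps * al j ^+ 2 by rewrite mulr_ge0 ?sqr_ge0// ltW.
have H1 : - 12 * B * (eps * al j ^+ 2) <= - 6 * eps * v (hp j) ^+ 2 *
     (sech2 ((m j - hp j) / eps) + sech2 ((m j.+1 - hp j) / eps)).
  rewrite -/(al j); have := ler_wpM2l e1 (lerD X1 X2); lra.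
have iG : integrable_on (m j) (m j.+1) (fun x => eps ^+ 2 * g x ^+ 2
    + f' (U ((x - hp j) / eps)) * v x ^+ 2).
  by apply: integrable_onD => //; exact: integrable_onZ.
rewrite RintegralB// in H; last exact/integrable_onZ/iM.
rewrite RintegralZl// in H; last exact: iM.
rewrite -/(Wj j) in H.
have : \int[leb]_(x in `[m j, m j.+1]) (eps ^+ 2 * g x ^+ 2
    + f' (U ((x - hp j) / eps)) * v x ^+ 2) - B * Vj j <=
  \int[leb]_(x in `[m j, m j.+1]) (eps ^+ 2 * g x ^+ 2 + f' (u x) * v x ^+ 2).
  rewrite -RintegralZl//; last exact: iM.
  rewrite -RintegralB//; last exact/integrable_onZ/iM.
  apply: le_Rintegral => //.
  - by apply: integrable_onB => //; exact/integrable_onZ/iM.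
  - by apply: integrable_onD => //; exact: integrable_onZ.
  - move=> x; rewrite /= in_itv/= => xj.
    have := ler_wpM2r (sqr_ge0 (v x)) (uB jN xj); lra.
lra.
Qed.

End PerLayer.

Let A_ge0 : 0 <= A. Proof. by apply: Rintegral_ge0 => x _; exact: normr_ge0. Qed.

Let V_ge0 : 0 <= V. Proof. by apply: Rintegral_ge0 => x _; exact: sqr_ge0. Qed.

Let A_le : A ^+ 2 <= V.
Proof.
have iv := abs_cont_integrable le01 vg; have iav := integrable_norm iv.
have H : 2 * A * A <= V + A ^+ 2 * \int[leb]_(x in `[0, 1]) 1.
  have i1 : integrable_on 0 1 (fun=> 1 : R).
    exact: (abs_cont_integrable le01 (abs_cont_cst _ _ 1)).
  have -> : 2 * A * A = \int[leb]_(x in `[0, 1]) (2 * A * `|v x|) by rewrite RintegralZl.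
  rewrite -(RintegralZl (A ^+ 2) _ i1)// -RintegralD//; last exact: integrable_onZ.
  apply: le_Rintegral => //; first exact: (integrable_onZ _ iav).
    by apply: integrable_onD => //; exact: integrable_onZ.
  move=> x _; rewrite -[v x ^+ 2]real_normK ?num_real//.
  by have := sqr_ge0 (`|v x| - A); rewrite /=; lra.
by move: H; rewrite Rintegral_itv_cst// subr0; lra.
Qed.

Theorem coercive : eps * (27 / 10 * V) <=
  eps ^+ 2 * \int[leb]_(x in `[0, 1]) (g x ^+ 2)
  + \int[leb]_(x in `[0, 1]) (f' (u x) * v x ^+ 2).
Proof.
have jle (j : 'I_N.+1) : (j <= N)%N by rewrite -ltnS.
have mean : \sum_(j < N.+1) (Iwj j + al j * pj j) = 0.
  transitivity (\int[leb]_(x in `[0, 1]) v x); last exact: v_mean0.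
  rewrite split_sum; last exact: (abs_cont_integrable le01 vg).
  by apply: eq_bigr => j _; rewrite (mean_split (jle j)).
have len1 : \sum_(j < N.+1) (m j.+1 - m j) = 1.
  by rewrite -(big_mkord xpredT (fun j => m j.+1 - m j)) telescope_sumr// m0 mN subr0.
have H := (@coercive_sums R N eps B A V Vj Wj Iwj Ivwj Tj pj al
  (fun j => m j.+1 - m j) N1 eps0 eps_small B0 B_small A_ge0 V_ge0 A_le VE
  (fun j _ => Wj_ge0 j) Vj_split mean Iwj_le len1 Ivwj_le Tj_sqr_le al_sqr_le pj_bounds orth).
apply: le_trans H _.
rewrite -RintegralZl// -RintegralD//; last exact: integrable_onZ.
rewrite split_sum; last by apply: integrable_onD => //; exact: integrable_onZ.
rewrite VE !mulr_sumr -!sumrB; apply: ler_sum => j _.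
exact: (layer_energy_ge (jle j)).
Qed.

End Coercivity.

(** * The geometry of well separated layers *)

Section Geometry.
Variable R : realType.
Variables (N : nat) (kappa0 eps : R).
Implicit Types (h : 'rV[R]_N.+1) (x : R).

Local Notation gap h j := (hext h j.+1 - hext h j).
Local Notation delta := (eps / rho kappa0 eps).

Lemma hext_ord h (j : 'I_N.+1) : hext h j.+1 = h ord0 j.
Proof. by rewrite /hext/= ltn_ord inord_val. Qed.

Lemma hext0 h : hext h 0 = - hext h 1.
Proof. by rewrite (hext_ord h ord0) /hext. Qed.

Lemma hextSS h : hext h N.+2 = 2 - hext h N.+1.
Proof. by rewrite (hext_ord h ord_max) /hext/= ltnn. Qed.

Hypothesis eps0 : 0 < eps.

Lemma delta_gt0 : 0 < delta.
Proof. by rewrite divr_gt0// powR_gt0. Qed.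

(** The reflected positions make the first and last gaps [2 h_1] and [2 (1 - h_(N+1))]. Positivity
    of the gaps thus encodes the ordering and the bounds 0 and 1 at once, and membership becomes a
    finite list of strict linear inequalities. *)
Lemma InOmegaP h : InOmega kappa0 eps h <->
  forall j, (j <= N.+1)%N -> delta < gap h j.
Proof.
have d0 := delta_gt0; split.
  move=> [h1 hS hN hgap] j jN; apply: (lt_le_trans (hgap j jN)).
  rewrite ger0_norm// subr_ge0; case: j jN => [_|j].
    by rewrite hext0; lra.
  rewrite ltnS leq_eqVlt => /predU1P[->|jN]; last by apply/ltW/hS.
  by rewrite hextSS; lra.
move=> H; split.
- by have := H 0%N isT; rewrite hext0; lra.
- by move=> j /andP[_ jN]; have := H j (leqW jN); lra.
- by have := H N.+1 (leqnn _); rewrite hextSS; lra.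
- by move=> j jN; apply: (lt_le_trans (H j jN)); exact: ler_norm.
Qed.

Lemma hext_affine h (h' : 'rV[R]_N.+1) (s : R) j :
  hext (h + s *: (h' - h)) j = hext h j + s * (hext h' j - hext h j).
Proof. by rewrite /hext; case: ifP => _; [|case: ifP => _]; rewrite !mxE; ring. Qed.

(** This is what allows the mean value theorem for [beta] along segments, since its derivatives in
    [h] are controlled only on this set. *)
Lemma InOmega_convex h h' (s : R) : 0 <= s <= 1 ->
  InOmega kappa0 eps h -> InOmega kappa0 eps h' ->
  InOmega kappa0 eps (h + s *: (h' - h)).
Proof.
move=> /andP[s0 s1] /InOmegaP H /InOmegaP H'; apply/InOmegaP => j jN.
rewrite !hext_affine; move: (H j jN) (H' j jN).
move: (hext h j.+1) (hext h j) (hext h' j.+1) (hext h' j) => a b a' b' ab ab'.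
have h1 : 0 <= s * (a' - b' - delta) by rewrite mulr_ge0//; lra.
have h2 : 0 <= (1 - s) * (a - b - delta) by rewrite mulr_ge0//; lra.
case: (ltP 0 s) => s2; last first.
  have -> : s = 0 by lra.
  lra.
have h3 : 0 < s * (a' - b' - delta) by rewrite mulr_gt0//; lra.
lra.
Qed.

Variable h : 'rV[R]_N.+1.
Hypothesis Oh : InOmega kappa0 eps h.

(** Thanks to the reflected positions the extreme midpoints are exactly 0 and 1, so the boundary
    pieces need no separate treatment. *)
Definition midpoint j := (hext h j + hext h j.+1) / 2.

Lemma midpoint0 : midpoint 0 = 0.
Proof. by rewrite /midpoint hext0; lra. Qed.

Lemma midpointS : midpoint N.+1 = 1.
Proof. by rewrite /midpoint hextSS; lra. Qed.

Lemma hext_gap j : (j <= N.+1)%N -> delta < gap h j.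
Proof. by move=> jN; apply: (InOmegaP h).1. Qed.

Lemma hext_le i j : (i <= j)%N -> (j <= N.+2)%N -> hext h i <= hext h j.
Proof.
have d0 := delta_gt0.
elim: j => [|j IH]; first by rewrite leqn0 => /eqP ->.
rewrite leq_eqVlt => /predU1P[->//|]; rewrite ltnS => ij jN.
by apply: (le_trans (IH ij (ltnW jN))); have := hext_gap jN; lra.
Qed.

Lemma midpoint_lt j : (j <= N)%N -> midpoint j < hext h j.+1 /\ hext h j.+1 < midpoint j.+1.
Proof.
have d0 := delta_gt0.
move=> jN; have h1 := hext_gap (leqW jN); have h2 : delta < gap h j.+1 by exact: hext_gap.
by rewrite /midpoint; split; lra.
Qed.

Variable E : R.
Hypothesis HE : forall y : R, 1 / (2 * rho kappa0 eps) <= `|y| -> sech2 y <= E.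

(** Half the minimal gap, measured in units of [eps], is the threshold [1 / (2 rho)] of [HE]. *)
Lemma sech2_far x y : delta / 2 <= `|x - y| -> sech2 ((x - y) / eps) <= E.
Proof.
move=> xy; apply: HE; rewrite normrM (gtr0_norm (_ : 0 < eps^-1)) ?invr_gt0//.
rewrite ler_pdivlMr//; apply: le_trans xy; rewrite le_eqVlt; apply/orP; left; apply/eqP.
by field; rewrite gt_eqF// powR_gt0.
Qed.

Lemma sech2_midpoint j : (j <= N)%N ->
  sech2 ((midpoint j - hext h j.+1) / eps) <= E /\
  sech2 ((midpoint j.+1 - hext h j.+1) / eps) <= E.
Proof.
move=> jN; have h1 := hext_gap (leqW jN); have h2 : delta < gap h j.+1 by exact: hext_gap.
split; apply: sech2_far; rewrite /midpoint.
  by rewrite distrC; apply: le_trans (ler_norm _); lra.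
by apply: le_trans (ler_norm _); lra.
Qed.

Lemma far_right j k x : (k < j)%N -> (j <= N)%N -> midpoint j <= x ->
  delta / 2 <= x - hext h k.+1.
Proof.
move=> kj jN; have h1 := hext_gap (leqW jN).
have := hext_le kj (leqW (leqW jN)).
rewrite /midpoint; lra.
Qed.

Lemma far_left j k x : (j < k)%N -> (k <= N)%N -> x <= midpoint j.+1 ->
  delta / 2 <= hext h k.+1 - x.
Proof.
move=> jk kN.
have h1 : delta < gap h j.+1 by apply: hext_gap; exact: leq_trans (leqW kN).
have := @hext_le j.+2 k.+1 jk (leqW kN).
rewrite /midpoint; lra.
Qed.

Lemma sech2_other j k x : (j <= N)%N -> (k <= N)%N -> k != j ->
  midpoint j <= x <= midpoint j.+1 -> sech2 ((x - hext h k.+1) / eps) <= E.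
Proof.
move=> jN kN; rewrite neq_ltn => /orP[kj|jk] /andP[x1 x2]; apply: sech2_far.
  by apply: le_trans (ler_norm _); exact: far_right x1.
by rewrite distrC; apply: le_trans (ler_norm _); exact: far_left x2.
Qed.

(** The difference of indicators is the limit of layer [k] on piece [j]: 1 to its right, -1 to its
    left, and 0 for [k = j], where the factor on [U] removes the layer itself. *)
Lemma U_other j k x : (j <= N)%N -> (k <= N)%N ->
  midpoint j <= x <= midpoint j.+1 ->
  `|U ((x - hext h k.+1) / eps) * (k != j)%:R - ((k < j)%:R - (j < k)%:R)| <= E.
Proof.
have d0 := delta_gt0.
move=> jN kN xj; have /andP[x1 x2] := xj.
have /andP[u1 u2] := U_bounds ((x - hext h k.+1) / eps).
have X0 := sech2_gt0 ((x - hext h k.+1) / eps).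
have XE : sech2 ((x - hext h k.+1) / eps) = 1 - U ((x - hext h k.+1) / eps) ^+ 2 by [].
case: (ltngtP k j) => kj /=.
- have XB := sech2_other jN kN (negbT (ltn_eqF kj)) xj.
  have U0' : 0 <= U ((x - hext h k.+1) / eps).
    by rewrite U_ge0// divr_ge0 ?(ltW eps0)//; have := far_right kj jN x1; lra.
  rewrite mulr1 subr0 distrC ger0_norm; last by lra.
  by move: XB; rewrite XE; nra.
- have XB := sech2_other jN kN (negbT (gtn_eqF kj)) xj.
  have U0' : U ((x - hext h k.+1) / eps) <= 0.
    rewrite U_le0// pmulr_lle0 ?invr_gt0//.
    by have := far_left kj kN x2; lra.
  rewrite mulr1 sub0r opprK ger0_norm; last by lra.
  by move: XB; rewrite XE; nra.
- rewrite mulr0 subrr subr0 normr0.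
  by have [+ _] := sech2_midpoint jN; apply: le_trans; rewrite ltW// sech2_gt0.
Qed.

(** Stated for every [n] to allow induction. At [n = N + 1 > j] the value is [(1 - (-1)^N) / 2], the
    opposite of the constant part of [beta]. *)
Lemma alternating_sign_sum j n :
  \sum_(k < n) (-1) ^+ k * ((k < j)%:R - (j < k)%:R) =
  (if (n <= j)%N then (1 - (-1) ^+ n) / 2 else (1 + (-1) ^+ n) / 2) :> R.
Proof.
elim: n => [|n IH]; first by rewrite big_ord0 expr0 subrr mul0r.
rewrite big_ord_recr/= IH exprS; case: (ltngtP n j) => nj /=.
- by lra.
- by lra.
- by lra.
Qed.

Variable beta : R -> 'rV[R]_N.+1 -> R -> R.
Hypothesis betaE : forall x, 0 <= x <= 1 ->
  `|beta eps h x - ((-1) ^+ N - 1) / 2| <= E.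

Lemma sub01 j x : (j <= N)%N -> midpoint j <= x <= midpoint j.+1 -> 0 <= x <= 1.
Proof.
move=> jN /andP[x1 x2]; rewrite -midpoint0 -midpointS /midpoint in x1 x2 *.
have := hext_le (leq0n j) (leqW (leqW jN)).
have := @hext_le 1 j.+1 (ltn0Sn _) (leqW jN).
have := @hext_le j.+1 N.+1 jN (leqW (leqnn _)).
have := @hext_le j.+2 N.+2 jN (leqnn _).
lra.
Qed.

(* Away from its own layer each summand is within [E] of [1] or [-1], and these
   limits telescope against the constant part of [beta]. *)
Lemma uh_near j x : (j <= N)%N -> midpoint j <= x <= midpoint j.+1 ->
  `|uh beta eps h x - (-1) ^+ j * U ((x - hext h j.+1) / eps)| <= N.+2%:R * E.
Proof.
move=> jN xj; pose j' : 'I_N.+1 := Ordinal (jN : (j < N.+1)%N).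
pose T k := U ((x - hext h k.+1) / eps).
have -> : uh beta eps h x - (-1) ^+ j * T j =
   \sum_(k < N.+1) (-1) ^+ k * (T k * (k != j :> nat)%:R - ((k < j)%:R - (j < k)%:R))
   + (beta eps h x - ((-1) ^+ N - 1) / 2).
  under eq_bigr do rewrite mulrBr.
  rewrite big_split/= sumrN alternating_sign_sum ltnNge jN/= exprS.
  rewrite /uh (bigD1 j')//= [in RHS](bigD1 j')//= eqxx mulr0 mulr0 add0r.
  rewrite -(hext_ord h j') -/(T j).
  have -> : \sum_(i < N.+1 | i != j') (-1) ^+ i * U ((x - h ord0 i) / eps) =
     \sum_(i < N.+1 | i != j') (-1) ^+ i * (T i * (i != j :> nat)%:R).
    apply: eq_bigr => i ij; rewrite /T hext_ord.
    have -> : (i != j :> nat) by move: ij; rewrite -val_eqE.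
    by rewrite mulr1.
  lra.
apply: (le_trans (ler_normD _ _)).
have -> : N.+2%:R * E = N.+1%:R * E + E by rewrite -[N.+2%:R]natr1; ring.
apply: lerD; last first.
  exact/betaE/sub01/xj.
apply: (le_trans (ler_norm_sum _ _ _)).
apply: (@le_trans _ _ (\sum_(k < N.+1) E)); last by rewrite sumr_const card_ord mulr_natl.
apply: ler_sum => k _; rewrite normrM normrX normrN1 expr1n mul1r.
by apply: U_other => //; rewrite -ltnS.
Qed.

(** The sign of the layer disappears because [f'] is even. The 9 comes from
    [3 |t^2 - u^2| <= 3 K (2 + K)] with [K <= 1]. *)
Lemma f'_uh_ge j x : N.+2%:R * E <= 1 -> (j <= N)%N ->
  midpoint j <= x <= midpoint j.+1 ->
  f' (U ((x - hext h j.+1) / eps)) - 9 * (N.+2%:R * E) <= f' (uh beta eps h x).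
Proof.
move=> E1 jN xj; have := uh_near jN xj.
have /andP[t1 t2] := U_bounds ((x - hext h j.+1) / eps).
set u := uh _ _ _ _; set t := U _; rewrite -/t in t1 t2.
rewrite -signr_odd; set K := _ * E; rewrite -/K in E1.
case: (odd j); rewrite ?expr1 ?expr0 ?mulN1r ?mul1r ?opprK => /ler_normlP[a b].
  rewrite /f'; nra.
rewrite /f'; nra.
Qed.

End Geometry.

(** * The mass constraint *)

Section DerivativesAlongCurves.
Variable R : realType.
Local Notation sqrt2 := (Num.sqrt 2 : R).

Lemma difference_quotient_line (V : normedModType R) (F : V -> R) (a v : V) (s : R) :
  (fun t : R => t^-1 *: (((fun t => F (a + t *: v)) \o shift s) (t *: 1) - F (a + s *: v))) =
  (fun t : R => t^-1 *: ((F \o shift (a + s *: v)) (t *: v) - F (a + s *: v))).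
Proof.
apply/funext => t /=; congr (_ *: (F _ - _)).
by rewrite [t *: 1]mulr1 scalerDl addrCA.
Qed.

Lemma derive_line (V : normedModType R) (F : V -> R) (a v : V) :
  'D_v F a = 'D_1 (fun t : R => F (a + t *: v)) 0.
Proof.
have := @difference_quotient_line V F a v 0; rewrite scale0r addr0 => H.
by rewrite /derive scale0r addr0 H.
Qed.

Lemma is_derive_line (V : normedModType R) (F : V -> R) (a v : V) (s : R) :
  differentiable F (a + s *: v) ->
  is_derive s 1 (fun t : R => F (a + t *: v)) ('D_v F (a + s *: v)).
Proof.
move=> dF; have H := difference_quotient_line F a v s.
by split; [rewrite /derivable H; exact: diff_derivable|rewrite /derive H].
Qed.

Lemma difference_quotient_cvg (F : R -> R) (d : R) : is_derive (0 : R) 1 F d ->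
  (fun t => t^-1 * (F t - F 0)) @ 0^' --> d.
Proof.
move=> [dF <-]; have := dF; rewrite /derivable /derive.
rewrite (_ : (fun h : R => _) = (fun t => t^-1 * (F t - F 0))) //.
by apply/funext => t /=; rewrite [t *: 1]mulr1 addr0.
Qed.

(** The mass of [beta] along a curve is known to vary little, but not to be differentiable. Passing
    to the limit in difference quotients of the explicit part [G] avoids differentiating that
    integral. *)
Lemma derive_lipschitz (G q : R -> R) (g' D E : R) : is_derive (0 : R) 1 G g' ->
  is_derive (0 : R) 1 q D -> q 0 = 0 ->
  (\forall t \near 0, `|G t - G 0| <= E * (`|t| + `|q t|)) ->
  `|g'| <= E * (1 + `|D|).
Proof.
move=> dG dq q0 HG.
have cG : (fun t => `|t^-1 * (G t - G 0)|) @ 0^' --> `|g'|.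
  by apply: cvg_norm; exact: difference_quotient_cvg.
have cq : (fun t => `|t^-1 * (q t - q 0)|) @ 0^' --> `|D|.
  by apply: cvg_norm; exact: difference_quotient_cvg.
have cr : (fun t => E * (1 + `|t^-1 * (q t - q 0)|)) @ 0^' --> E * (1 + `|D|).
  by apply: cvgM; [exact: cvg_cst|apply: cvgD; [exact: cvg_cst|exact: cq]].
apply: (ler_cvg_to cG cr); near=> t.
have t0 : t != 0 by near: t; exact: nbhs_dnbhs_neq.
rewrite q0 subr0 !normrM normfV -ler_pdivlMl ?invr_gt0 ?normr_gt0// invrK.
rewrite mulrCA mulrDr mulr1 mulrA divff ?normr_eq0// mul1r.
by near: t; apply: nbhs_dnbhs.
Unshelve. all: by end_near. Qed.

Lemma is_derive_scale_vector (V : normedModType R) (k : R -> R) (d t : R) (e : V) :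
  is_derive t 1 k d -> is_derive t 1 (fun t => k t *: e) (d *: e).
Proof.
move=> [dk kd]; have dk' : differentiable k t by apply/derivable1_diffP.
have dke : differentiable (fun t => k t *: e) t by exact: differentiableZl.
split; first exact/derivable1_diffP.
by rewrite (deriveE _ dke) (diffZl e dk') /= -(deriveE _ dk') kd.
Qed.

Lemma is_derive_affine_curve (V : normedModType R) (h e1 e2 : V) (q : R -> R) (D : R) :
  is_derive (0 : R) 1 q D ->
  is_derive (0 : R) 1 (fun t => h + (t *: e1 + q t *: e2)) (e1 + D *: e2).
Proof.
move=> dq; have d2 := is_derive_scale_vector e2 dq.
have d1 := is_derive_scale_vector e1 (is_derive_id (0 : R) (1 : R)).
have d12 := is_deriveD d1 d2.
have := is_deriveD (is_derive_cst h (0 : R) (1 : R)) d12.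
by rewrite scale1r add0r.
Qed.

Definition layer_mass (eps h : R) : R := \int[leb]_(x in `[0, 1]) U ((x - h) / eps).

(** The explicit primitive [sqrt 2 * eps * ln (2 cosh)] of the profile; it turns the derivative of
    the mass with respect to the layer position into boundary values. *)
Let antiderivative (eps y : R) := sqrt2 * eps *
  ln (expR (y / (sqrt2 * eps)) + expR (- (y / (sqrt2 * eps)))).

Lemma is_derive_antiderivative (eps y : R) : 0 < eps ->
  is_derive y 1 (antiderivative eps) (U (y / eps)).
Proof.
move=> e0; have c0 : sqrt2 * eps != 0 by rewrite mulf_neq0 ?gt_eqF// sqrt2_gt0.
have d1 : is_derive y 1 (fun y => y / (sqrt2 * eps)) ((sqrt2 * eps)^-1).
  by apply: is_derive_eq; rewrite /GRing.scale/=; ring.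
have d2 : is_derive y 1 (fun y => expR (y / (sqrt2 * eps)) + expR (- (y / (sqrt2 * eps))))
   ((sqrt2 * eps)^-1 * (expR (y / (sqrt2 * eps)) - expR (- (y / (sqrt2 * eps))))).
  by apply: is_derive_eq; rewrite /GRing.scale/=; ring.
have p0 : 0 < expR (y / (sqrt2 * eps)) + expR (- (y / (sqrt2 * eps))).
  by rewrite addr_gt0 ?expR_gt0.
have d3 := is_derive1_ln p0.
rewrite /antiderivative; apply: is_derive_eq; rewrite /GRing.scale/= /U /tanh.
have -> : y / eps / sqrt2 = y / (sqrt2 * eps) by rewrite invfM mulrA mulrAC.
set a := expR _; set b := expR _; rewrite -/a -/b in p0.
field.
by rewrite (gt_eqF e0) (gt_eqF (sqrt2_gt0 R)) (gt_eqF p0).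
Qed.

Lemma is_derive_layer_mass (eps h : R) : 0 < eps ->
  is_derive h 1 (layer_mass eps) (- (U ((1 - h) / eps) - U ((0 - h) / eps))).
Proof.
move=> e0.
have E : layer_mass eps = fun h => antiderivative eps (1 - h) - antiderivative eps (0 - h).
  apply/funext => h'; rewrite /layer_mass.
  have [_ H] : abs_cont 0 1 (fun x => antiderivative eps (x - h')) (fun x => U ((x - h') / eps)).
    apply: (abs_cont_C1 (ltr01 : (0 : R) < 1)) => x _; last exact: layer_continuous.
    have d := is_derive_antiderivative (x - h') e0.
    by apply: is_derive_eq; rewrite /GRing.scale/=; ring.
  have := H 1; rewrite ler01 lexx => /(_ isT) ->; ring.
rewrite E; have d1 := is_derive_antiderivative (1 - h) e0.
have d0 := is_derive_antiderivative (0 - h) e0.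
by apply: is_derive_eq; rewrite /GRing.scale/=; ring.
Qed.

End DerivativesAlongCurves.

Lemma sumD2 (R : realType) n (a b : 'I_n) (F : 'I_n -> R) : a != b ->
  \sum_j F j = F a + F b + \sum_(j | (j != a) && (j != b)) F j.
Proof. by move=> ab; rewrite (bigD1 a)//= (bigD1 b)/= ?addrA// eq_sym. Qed.

Lemma subr_eq_of_eq_sum (R : zmodType) (a b c x y m : R) :
  a + c + x = m -> b + c + y = m -> a - b = - (x - y).
Proof.
move=> E1 E2; apply/eqP; rewrite opprB subr_eq addrAC eq_sym subr_eq.
by rewrite -(inj_eq (addIr c)) [y + b]addrC addrAC E2 addrAC E1.
Qed.

(** The error term itself contains [|d|], so a crude bound [|d| <= 13/10] is obtained before the
    precise one. *)
Lemma constraint_coefficient (R : realFieldType) (E a b d : R) : 0 <= E <= 1 / 10 ->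
  2 - 2 * E <= a <= 2 -> 2 - 2 * E <= b <= 2 ->
  `|- b - d * a| <= E * (1 + `|d|) -> `|d + 1| <= 4 * E.
Proof.
move=> /andP[E0 E1] /andP[a1 a2] /andP[b1 b2] H.
have d2 : `|d| <= 13 / 10.
  have h1 : `|d| * a <= `|- b - d * a| + b.
    have -> : `|d| * a = `|d * a| by rewrite normrM (ger0_norm (_ : 0 <= a))//; lra.
    have b0 : 0 <= b by lra.
    have -> : `|d * a| = `|(- b - d * a) + b|.
      by rewrite -[RHS]normrN; congr (`|_|); ring.
    by apply: (le_trans (ler_normD _ _)); rewrite (ger0_norm b0).
  have n0 := normr_ge0 d.
  have h2 : `|d| * (18 / 10) <= `|d| * a by apply: ler_wpM2l => //; lra.
  have h3 : E * (1 + `|d|) <= 1 / 10 * (1 + `|d|) by apply: ler_wpM2r; lra.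
  lra.
have h3 : E * (1 + `|d|) <= E * (23 / 10) by apply: ler_wpM2l => //; lra.
have da : `|d * (2 - a)| <= 13 / 10 * (2 * E).
  rewrite normrM; apply: ler_pM => //.
  by rewrite ger0_norm; lra.
have -> : d + 1 = 2^-1 * ((2 - b) - (- b - d * a) + d * (2 - a)) by field.
rewrite normrM (ger0_norm (_ : 0 <= 2^-1)) ?invr_ge0//.
have h4 := ler_normD (2 - b - (- b - d * a)) (d * (2 - a)).
have h5 := ler_normB (2 - b) (- b - d * a).
have h6 : `|2 - b| <= 2 * E by rewrite ger0_norm; lra.
lra.
Qed.

(** The [X] terms cancel by [s * s = 1]. What is left is [(s r d + 1) Y], at most [4 E], and the
    [beta] terms, at most [3/2 * 24/10 * E]. *)
Lemma remainder_bound (R : realFieldType) (s r E X Y c d y1 y2 : R) :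
  0 <= E <= 1 / 10 -> 0 < c -> c <= 3 / 2 -> 0 <= Y -> Y <= 1 ->
  s * s = 1 -> `|s| = 1 -> `|r| = 1 -> `|s * r * d + 1| <= 4 * E ->
  `|y1| <= E -> `|y2| <= E ->
  `|X - Y + s * c * (- (s * X + d * (r * Y)) / c + (y1 + d * y2))| <= 9 * E.
Proof.
move=> /andP[E0 E1] c0 c1 X0 X1 ss ns nr cE b1 b2.
have -> : X - Y + s * c * (- (s * X + d * (r * Y)) / c + (y1 + d * y2)) =
   - ((s * r * d + 1) * Y) + s * c * (y1 + d * y2).
  have -> : s * c * (- (s * X + d * (r * Y)) / c + (y1 + d * y2)) =
    - (s * s * X + s * d * (r * Y)) + s * c * (y1 + d * y2).
    by field; rewrite gt_eqF.
  by rewrite ss; ring.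
have nd : `|d| <= 14 / 10.
  have -> : `|d| = `|s * r * d| by rewrite !normrM ns nr !mul1r.
  have -> : s * r * d = (s * r * d + 1) - 1 by ring.
  by apply: (le_trans (ler_normB _ _)); rewrite normr1; lra.
apply: (le_trans (ler_normD _ _)); rewrite normrN !normrM ns mul1r (gtr0_norm c0) (ger0_norm X0).
have h1 : `|s * r * d + 1| * Y <= 4 * E * 1 by apply: ler_pM.
have h2 : `|y1 + d * y2| <= 24 / 10 * E.
  apply: (le_trans (ler_normD _ _)); rewrite normrM.
  have : `|d| * `|y2| <= 14 / 10 * E by apply: ler_pM.
  lra.
have h3 : c * `|y1 + d * y2| <= 3 / 2 * (24 / 10 * E) by apply: ler_pM => //; exact: ltW.
lra.
Qed.

(** * Moving one layer while the mass is kept fixed *)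

Section Constraint.
Variable R : realType.
Local Notation sqrt2 := (Num.sqrt 2 : R).
Variables (N : nat) (kappa0 eps mass E : R).
Variables (beta : R -> 'rV[R]_N.+1 -> R -> R) (p : 'rV[R]_N -> R).
Variables (xi : 'rV[R]_N) (i : 'I_N).

Let h0 := hxi p xi.
Let ei := delta_mx ord0 i : 'rV[R]_N.
Let i' := lift ord_max i : 'I_N.+1.
Let q t := p (xi + t *: ei) - p xi.
Let D := 'D_ei p xi.
(** The curve along which [uxi_i] differentiates: layer [i] moves by [t], the last layer by [q t],
    and all others stay. *)
Let H t := hxi p (xi + t *: ei).
Let e1 := delta_mx ord0 i' : 'rV[R]_N.+1.
Let e2 := delta_mx ord0 ord_max : 'rV[R]_N.+1.

Hypothesis eps0 : 0 < eps.
Hypothesis E01 : 0 <= E <= 1 / 10.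
Hypothesis Oh : InOmega kappa0 eps h0.
Hypothesis dp : differentiable p xi.
Hypothesis beta_x : forall h x, derivable (beta eps h) x 1.
Hypothesis beta_h : forall h x, InOmega kappa0 eps h ->
  differentiable (fun h' => beta eps h' x) h.
Hypothesis beta_bound : forall h x (j : 'I_N.+1), InOmega kappa0 eps h -> 0 <= x <= 1 ->
  `|'D_(delta_mx ord0 j) (fun h' => beta eps h' x) h| <= E.
Hypothesis mass_iff : forall h, InOmega kappa0 eps h ->
  (\int[leb]_(x in `[0, 1]) uh beta eps h x = mass <-> h ord0 ord_max = p (xipart h)).
Hypothesis HE : forall y : R, 1 / (2 * rho kappa0 eps) <= `|y| -> sech2 y <= E.

Let q0 : q 0 = 0. Proof. by rewrite /q scale0r addr0 subrr. Qed.

Let H_E t : H t = h0 + (t *: e1 + q t *: e2).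
Proof.
apply/rowP => k; rewrite /H /h0 !mxE !eqxx/=.
case: (unliftP ord_max k) => [k' ->|->].
  rewrite !mxE eqxx/= (inj_eq lift_inj) [_ == ord_max]eq_sym (negPf (neq_lift _ _)).
  by rewrite mulr0 addr0.
by rewrite (negPf (neq_lift _ _)) eqxx mulr0 mulr1 add0r /q addrC subrK.
Qed.

Let H0 : H 0 = h0.
Proof. by rewrite H_E q0 !scale0r !addr0. Qed.

Let is_derive_q : is_derive (0 : R) 1 q D.
Proof.
have d : differentiable p (xi + 0 *: ei) by rewrite scale0r addr0.
have := is_derive_line d; rewrite scale0r addr0 -/D => d'.
by apply: is_derive_eq; rewrite subr0.
Qed.

Let diff_q : differentiable q 0.
Proof. by apply/derivable1_diffP; case: is_derive_q. Qed.

Let H_fun : H = (fun t => h0 + (t *: e1 + q t *: e2)).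
Proof. by apply/funext => t; rewrite H_E. Qed.

Let is_derive_H : is_derive (0 : R) 1 H (e1 + D *: e2).
Proof. by rewrite H_fun; apply: is_derive_affine_curve. Qed.

Let diff_H : differentiable H 0.
Proof. by apply/derivable1_diffP; case: is_derive_H. Qed.

Let D_H : 'd H 0 1 = e1 + D *: e2.
Proof. by rewrite -(deriveE _ diff_H); case: is_derive_H. Qed.

Lemma derive_lin2 (F : 'rV[R]_N.+1 -> R) h (s t : R) : differentiable F h ->
  'D_(s *: e1 + t *: e2) F h = s * 'D_e1 F h + t * 'D_e2 F h.
Proof. by move=> dF; rewrite !deriveE// linearD !linearZ. Qed.

Lemma is_derive_curve (F : 'rV[R]_N.+1 -> R) : differentiable F h0 ->
  is_derive (0 : R) 1 (fun t => F (H t)) ('D_e1 F h0 + D * 'D_e2 F h0).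
Proof.
move=> dF; have dF' : differentiable F (H 0) by rewrite H0.
have dc : differentiable (F \o H) 0 by exact: differentiable_comp.
split; first exact/derivable1_diffP.
rewrite deriveE// diff_comp//= D_H H0.
by rewrite -[e1 in LHS]scale1r -deriveE// derive_lin2// mul1r.
Qed.

(** Finitely many strict inequalities between quantities continuous along the curve. It is needed
    because the mass relation and the bounds on [beta] are available only inside [InOmega]. *)
Lemma near_InOmega : \forall t \near (0 : R), InOmega kappa0 eps (H t).
Proof.
have cq : q @ (0 : R) --> (0 : R).
  by rewrite -[X in _ --> X]q0; exact: differentiable_continuous.
have cH k : (fun t => H t ord0 k) @ (0 : R) --> h0 ord0 k.
  rewrite (_ : (fun t => _) = fun t => h0 ord0 k + (t * e1 ord0 k + q t * e2 ord0 k)); last first.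
    by apply/funext => t; rewrite H_E !mxE.
  rewrite -[X in _ --> X]addr0; apply: cvgD; first exact: cvg_cst.
  rewrite -[X in _ --> X]addr0; apply: cvgD.
    by rewrite -[X in _ --> X](mul0r (e1 ord0 k)); apply: cvgM; [exact: cvg_id|exact: cvg_cst].
  rewrite -[X in _ --> X](mul0r (e2 ord0 k)); apply: cvgM; last exact: cvg_cst.
  exact: cq.
have ch j : (fun t => hext (H t) j) @ (0 : R) --> hext h0 j.
  rewrite /hext; case: ifP => _; first exact: cvgN.
  by case: ifP => _ //; apply: cvgB; [exact: cvg_cst|exact: cH].
have := @filter_forall R 'I_N.+2
  (fun j t => eps / rho kappa0 eps < hext (H t) j.+1 - hext (H t) j) (nbhs (0 : R)) _.
have gaps (j : 'I_N.+2) : \forall t \near (0 : R),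
    eps / rho kappa0 eps < hext (H t) j.+1 - hext (H t) j.
  have c : (fun t => hext (H t) j.+1 - hext (H t) j) @ (0 : R) --> hext h0 j.+1 - hext h0 j.
    by apply: cvgB; exact: ch.
  have z : eps / rho kappa0 eps < hext h0 j.+1 - hext h0 j.
    by apply: ((InOmegaP kappa0 eps0 h0).1 Oh); rewrite -ltnS.
  exact: (cvgr_gt _ c _ z).
move=> /(_ _ gaps).
apply: filterS => t Ht; apply/(InOmegaP _ eps0) => j jN.
exact: (Ht (Ordinal (jN : (j < N.+2)%N))).
Qed.

Lemma beta_lipschitz h (s t x : R) : 0 <= x <= 1 ->
  InOmega kappa0 eps h -> InOmega kappa0 eps (h + (s *: e1 + t *: e2)) ->
  `|beta eps (h + (s *: e1 + t *: e2)) x - beta eps h x| <= E * (`|s| + `|t|).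
Proof.
move=> x01 O1 O2; set v := s *: e1 + t *: e2.
have O (s' : R) : 0 <= s' <= 1 -> InOmega kappa0 eps (h + s' *: v).
  move=> s01; have := InOmega_convex eps0 s01 O1 O2.
  by rewrite (_ : h + v - h = v)//; rewrite addrAC subrr add0r.
pose F h' := beta eps h' x.
have dl (s' : R) : 0 <= s' <= 1 ->
    is_derive s' 1 (fun s' : R => F (h + s' *: v)) ('D_v F (h + s' *: v)).
  by move=> s01; apply: is_derive_line; apply: beta_h; exact: O.
have M1 (y : R) : y \in `]0, 1[ ->
    is_derive y 1 (fun s' : R => F (h + s' *: v)) ('D_v F (h + y *: v)).
  by rewrite in_itv/= => /andP[y0 y1]; apply: dl; rewrite !ltW.
have M2 : {within `[0, 1], continuous (fun s' : R => F (h + s' *: v))}.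
  apply: continuous_in_subspaceT => y; rewrite inE/= in_itv/= => /dl.
  exact: is_derive_continuous.
have [c] := MVT ltr01 M1 M2.
rewrite in_itv/= => /andP[c0 c1].
rewrite scale1r scale0r addr0 subr0 mulr1 => ->.
have Oc : InOmega kappa0 eps (h + c *: v) by apply: O; rewrite !ltW.
rewrite /v derive_lin2; last exact: beta_h.
apply: (le_trans (ler_normD _ _)); rewrite !normrM mulrDr.
by apply: lerD; rewrite mulrC ler_wpM2r//; exact: beta_bound.
Qed.

Let beta_cont h : continuous (beta eps h).
Proof. by move=> x; apply: differentiable_continuous; apply/derivable1_diffP. Qed.

Let beta_int h : integrable_on 0 1 (beta eps h).
Proof.
apply: continuous_compact_integrable; first exact: segment_compact.
exact: continuous_subspaceT.
Qed.

Let U_int (y : R) : integrable_on 0 1 (fun x => U ((x - y) / eps)).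
Proof.
apply: continuous_compact_integrable; first exact: segment_compact.
by apply: continuous_subspaceT; exact: layer_continuous.
Qed.

Let sum_int n (c y : nat -> R) :
  integrable_on 0 1 (fun x => \sum_(j < n) c j * U ((x - y j) / eps)) /\
  \int[leb]_(x in `[0, 1]) (\sum_(j < n) c j * U ((x - y j) / eps)) =
  \sum_(j < n) c j * layer_mass eps (y j).
Proof.
elim: n => [|n [IHi IHe]].
  under eq_Rintegral do rewrite big_ord0.
  rewrite big_ord0 Rintegral_cst// mul0r; split => //.
  under [X in EFin \o X]eq_fun do rewrite big_ord0.
  exact: integrable0.
split.
  under [X in EFin \o X]eq_fun do rewrite big_ord_recr/=.
  by apply: integrable_onD => //; exact/integrable_onZ/U_int.
under eq_Rintegral do rewrite big_ord_recr/=.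
rewrite RintegralD//; last exact/integrable_onZ/U_int.
by rewrite big_ord_recr/= IHe RintegralZl//; exact: U_int.
Qed.

Lemma uh_mass h : \int[leb]_(x in `[0, 1]) uh beta eps h x =
  \sum_(j < N.+1) (-1) ^+ j * layer_mass eps (h ord0 j)
  + \int[leb]_(x in `[0, 1]) beta eps h x.
Proof.
pose y k := hext h k.+1.
have [si sE] := sum_int N.+1 (fun j => (-1) ^+ j) y.
have E1 x : \sum_(j < N.+1) (-1) ^+ j * U ((x - h ord0 j) / eps) =
    \sum_(j < N.+1) (-1) ^+ j * U ((x - y j) / eps).
  by apply: eq_bigr => j _; rewrite /y hext_ord.
rewrite /uh; under eq_Rintegral do rewrite E1.
rewrite RintegralD// sE; congr (_ + _).
by apply: eq_bigr => j _; rewrite /y hext_ord.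
Qed.

Let hxi_max xi' : hxi p xi' ord0 ord_max = p xi'.
Proof. by rewrite mxE unlift_none. Qed.

Let xipart_hxi xi' : xipart (hxi p xi') = xi'.
Proof. by apply/rowP => k; rewrite !mxE liftK. Qed.

Let mass_hxi xi' : InOmega kappa0 eps (hxi p xi') ->
  \int[leb]_(x in `[0, 1]) uh beta eps (hxi p xi') x = mass.
Proof. by move=> O; apply/(mass_iff O); rewrite hxi_max xipart_hxi. Qed.

Let Hi t : H t ord0 i' = h0 ord0 i' + t.
Proof.
rewrite H_E !mxE !eqxx/= -/i' (_ : (i' == ord_max) = false); last first.
  by rewrite eq_sym; apply/negbTE/neq_lift.
by rewrite mulr0 mulr1 addr0.
Qed.

Let Hmax t : H t ord0 ord_max = h0 ord0 ord_max + q t.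
Proof.
rewrite H_E !mxE !eqxx/= -/i' (_ : (ord_max == i') = false); last first.
  by apply/negbTE/neq_lift.
by rewrite mulr0 mulr1 add0r.
Qed.

Let Hother t k : k != i' -> k != ord_max -> H t ord0 k = h0 ord0 k.
Proof.
by move=> ki kN; rewrite H_E !mxE !eqxx/= (negPf ki) (negPf kN) !mulr0 !addr0.
Qed.

Let G t := (-1) ^+ i * layer_mass eps (h0 ord0 i' + t)
  + (-1) ^+ N * layer_mass eps (h0 ord0 ord_max + q t).

Let i'E : nat_of_ord i' = i. Proof. by rewrite /i' lift_max. Qed.

Let G_sum t : \sum_(j < N.+1) (-1) ^+ j * layer_mass eps (H t ord0 j) =
  G t + \sum_(j < N.+1 | (j != i') && (j != ord_max)) (-1) ^+ j * layer_mass eps (h0 ord0 j).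
Proof.
have i'max : i' != ord_max by rewrite eq_sym; exact: neq_lift.
rewrite (sumD2 _ i'max) Hi Hmax i'E; congr (_ + _).
by apply: eq_bigr => j /andP[ji jN]; rewrite Hother.
Qed.

(** The total mass is constant along the curve and the unmoved layers cancel, so the change of [G]
    is minus that of the integral of [beta]. *)
Let G_lip : \forall t \near (0 : R), `|G t - G 0| <= E * (`|t| + `|q t|).
Proof.
apply: filterS near_InOmega => t Ot.
have m1 := mass_hxi Ot; have m2 := mass_hxi Oh.
rewrite uh_mass -/(H t) G_sum in m1; rewrite -/h0 -H0 uh_mass G_sum H0 in m2.
rewrite (subr_eq_of_eq_sum m1 m2).
rewrite normrN -RintegralB//.
have ib : integrable_on 0 1 (fun x => beta eps (H t) x - beta eps h0 x).
  exact: integrable_onB.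
apply: (le_trans (le_normr_Rintegral _ ib)) => //.
have icst : integrable_on 0 1 (fun=> E * (`|t| + `|q t|)).
  exact: (abs_cont_integrable ler01 (abs_cont_cst _ _ _)).
apply: (@le_trans _ _ (\int[leb]_(x in `[0, 1]) (E * (`|t| + `|q t|)))).
  apply: le_Rintegral => //; first exact: integrable_norm.
  move=> x; rewrite /= in_itv/= => x01; rewrite H_E.
  by apply: beta_lipschitz => //; rewrite -H_E.
by rewrite Rintegral_itv_cst ?ltr01// subr0 mulr1.
Qed.

Lemma layer_mass_derive k : (k <= N)%N ->
  2 - 2 * E <= U ((1 - hext h0 k.+1) / eps) - U ((0 - hext h0 k.+1) / eps) <= 2.
Proof.
move=> kN; have d0 := delta_gt0 kappa0 eps0.
have a1 : eps / rho kappa0 eps / 2 <= 1 - hext h0 k.+1.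
  have := hext_le eps0 Oh (kN : (k < N.+1)%N) (leqW (leqnn _)).
  by have := hext_gap eps0 Oh (leqnn N.+1); rewrite hextSS; lra.
have a2 : eps / rho kappa0 eps / 2 <= hext h0 k.+1.
  have := @hext_le _ _ _ _ eps0 _ Oh 1 k.+1 (ltn0Sn _) (leqW kN).
  by have := hext_gap eps0 Oh (leq0n N.+1); rewrite hext0; lra.
have f1 := sech2_far eps0 HE (le_trans a1 (ler_norm _)).
have f2 : sech2 ((0 - hext h0 k.+1) / eps) <= E.
  by apply: (sech2_far eps0 HE); rewrite distrC subr0; exact: le_trans a2 (ler_norm _).
have /andP[u1 u2] := U_bounds ((1 - hext h0 k.+1) / eps).
have /andP[u3 u4] := U_bounds ((0 - hext h0 k.+1) / eps).
have s1 : 0 <= U ((1 - hext h0 k.+1) / eps).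
  by rewrite U_ge0// divr_ge0 ?(ltW eps0)//; lra.
have s2 : U ((0 - hext h0 k.+1) / eps) <= 0.
  by rewrite U_le0// pmulr_lle0 ?invr_gt0//; lra.
move: f1 f2; rewrite /sech2; nra.
Qed.

(* The mass constraint forces the last layer to compensate the displacement of
   the [i]-th one. *)
Lemma constraint_derivative : `|(-1) ^+ (i + N) * D + 1| <= 4 * E.
Proof.
have dG : is_derive (0 : R) 1 G
  ((-1) ^+ i * - (U ((1 - h0 ord0 i') / eps) - U ((0 - h0 ord0 i') / eps))
   + (-1) ^+ N * (D * - (U ((1 - h0 ord0 ord_max) / eps) - U ((0 - h0 ord0 ord_max) / eps)))).
  have d1 := is_derive_layer_mass (h0 ord0 i' + 0) eps0.
  have d2 := is_derive_layer_mass (h0 ord0 ord_max + q 0) eps0.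
  have dq := is_derive_q.
  apply: is_derive_eq; rewrite q0 !addr0 /GRing.scale/=; ring.
have := derive_lipschitz dG is_derive_q q0 G_lip.
have iN : (i <= N)%N by apply: ltnW.
have := layer_mass_derive iN; have := layer_mass_derive (leqnn N).
have -> : hext h0 i.+1 = h0 ord0 i' by rewrite -hext_ord i'E.
have -> : hext h0 N.+1 = h0 ord0 ord_max by rewrite -hext_ord.
set a := U ((1 - h0 ord0 ord_max) / eps) - _; set b := U ((1 - h0 ord0 i') / eps) - _.
move=> /andP[a1 a2] /andP[b1 b2].
have /andP[E0 E1] := E01.
pose s : R := (-1) ^+ i; pose r : R := (-1) ^+ N.
have ns : `|s| = 1 by rewrite normrX normrN1 expr1n.
have nr : `|r| = 1 by rewrite normrX normrN1 expr1n.
have ss : s * s = 1 by rewrite /s -expr2 sqrr_sign.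
have nD : `|D| = `|s * r * D| by rewrite !normrM ns nr !mul1r.
rewrite exprD -/s -/r.
have -> : s * - b + r * (D * - a) = s * (- b - s * r * D * a).
  by rewrite mulrBr !mulrA ss mul1r; ring.
rewrite normrM ns mul1r nD; move: (s * r * D) => d.
by move=> h1; apply: (@constraint_coefficient _ E a b) => //; rewrite ?a1 ?b1 ?E0.
Qed.

Let Xi x := sech2 ((x - h0 ord0 i') / eps).
Let XN x := sech2 ((x - h0 ord0 ord_max) / eps).
Let db x := 'D_e1 (fun h => beta eps h x) h0 + D * 'D_e2 (fun h => beta eps h x) h0.

Lemma is_derive_uh_curve x : is_derive (0 : R) 1 (fun t => uh beta eps (H t) x)
  (- ((-1) ^+ i * Xi x + D * ((-1) ^+ N * XN x)) / (sqrt2 * eps) + db x).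
Proof.
pose rest := \sum_(j < N.+1 | (j != i') && (j != ord_max))
  (-1) ^+ j * U ((x - h0 ord0 j) / eps).
pose F t := beta eps (H t) x.
have i'max : i' != ord_max by rewrite eq_sym; exact: neq_lift.
have -> : (fun t => uh beta eps (H t) x) = (fun t =>
    (-1) ^+ i * U ((x - h0 ord0 i' - t) / eps)
    + (-1) ^+ N * U ((x - h0 ord0 ord_max - q t) / eps) + rest + F t).
  apply/funext => t; rewrite /uh (sumD2 _ i'max) Hi Hmax i'E /= !opprD !addrA.
  congr (_ + _ + _).
  by apply: eq_bigr => j /andP[ji jN]; rewrite Hother.
have d1 : is_derive (0 : R) 1 F (db x).
  exact: is_derive_curve (beta_h _ Oh).
have d2 := is_derive_U ((x - h0 ord0 i' - 0) / eps).
have d3 := is_derive_U ((x - h0 ord0 ord_max - q 0) / eps).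
have dq := is_derive_q.
rewrite /Xi /XN; move: (db x) rest F d1 => b r F d1.
apply: is_derive_eq; rewrite q0 !subr0 /GRing.scale/= invfM; ring.
Qed.

Lemma uxi_iE x : uxi_i beta eps p xi i x =
  - ((-1) ^+ i * Xi x + D * ((-1) ^+ N * XN x)) / (sqrt2 * eps) + db x.
Proof.
rewrite /uxi_i derive_line; have := is_derive_uh_curve x; case=> _ <- //.
Qed.

Lemma uh_integrable h : integrable_on 0 1 (uh beta eps h).
Proof.
have [si _] := sum_int N.+1 (fun j => (-1) ^+ j) (fun k => hext h k.+1).
rewrite /uh; apply: integrable_onD => //.
by under [X in EFin \o X]eq_fun do under eq_bigr do rewrite -hext_ord.
Qed.

(** The derivative of [beta] in [h] comes with no regularity in [x]. Measurability is obtained from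
    a pointwise limit of difference quotients with increments [1 / (n + 1)]. *)
Lemma uxi_i_measurable : measurable_fun `[(0 : R), 1] (uxi_i beta eps p xi i).
Proof.
pose u n x := n.+1%:R * (uh beta eps (H n.+1%:R^-1) x - uh beta eps (H 0) x) : R.
apply: (measurable_fun_cvg (h := u)).
  move=> n; have := uh_integrable (H n.+1%:R^-1); have := uh_integrable (H 0).
  move=> /measurable_int /measurable_EFinP m0 /measurable_int /measurable_EFinP m1.
  by apply: measurable_funM => //; apply: measurable_funB.
move=> x _; rewrite uxi_iE.
have c := difference_quotient_cvg (is_derive_uh_curve x).
have h0' : (fun n => n.+1%:R^-1 : R) @ \oo --> (0 : R)^'.
  move=> A hA; have hA' : \forall y \near (0 : R), y != 0 -> A y by exact: hA.
  have hn : \forall n \near \oo, (n.+1%:R^-1 : R) != 0 -> A (n.+1%:R^-1 : R).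
    exact: (@cvg_harmonic R _ hA').
  rewrite /nbhs /=; apply: filterS hn => n /= An.
  have pos : (n.+1%:R^-1 : R) != 0 by rewrite invr_eq0 pnatr_eq0.
  exact: An.
have := cvg_comp _ _ h0' c.
by under [X in X @ _]eq_fun do rewrite /= invrK.
Qed.

Hypothesis eps1 : eps <= 1.

(** After multiplication by [(-1)^i * sqrt 2 * eps], the tangent vector [uxi_i] is [XN - Xi] up to
    this error. The two profiles enter with opposite signs whatever the parities of [i] and [N],
    because the derivative of the last position carries the sign [- (-1)^(i+N)]. *)
Let rem x := Xi x - XN x + (-1) ^+ i * (sqrt2 * eps) * uxi_i beta eps p xi i x.

Lemma rem_bound x : 0 <= x <= 1 -> `|rem x| <= 9 * E.
Proof.
move=> x01; rewrite /rem uxi_iE.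
have c0 : 0 < sqrt2 * eps by rewrite mulr_gt0// sqrt2_gt0.
have cE := constraint_derivative.
have b1 := beta_bound i' Oh x01; have b2 := beta_bound ord_max Oh x01.
have X0 : 0 <= XN x by rewrite ltW// sech2_gt0.
have X1 : XN x <= 1 by exact: sech2_le1.
have /andP[_ s2] := sqrt2_bounds R.
have c1 : sqrt2 * eps <= 3 / 2.
  by rewrite -[X in _ <= X]mulr1; apply: ler_pM => //; rewrite ltW// sqrt2_gt0.
rewrite /db -/e1 -/e2 in b1 b2 *; rewrite exprD in cE.
have ss : (-1) ^+ i * (-1) ^+ i = 1 :> R by rewrite -expr2 sqrr_sign.
have ns : `|(-1) ^+ i : R| = 1 by rewrite normrX normrN1 expr1n.
have nr : `|(-1) ^+ N : R| = 1 by rewrite normrX normrN1 expr1n.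
exact: remainder_bound.
Qed.

Lemma orthogonality (v g : R -> R) : abs_cont 0 1 v g ->
  ip01 v (uxi_i beta eps p xi i) = 0 ->
  `|\int[leb]_(x in `[0, 1]) (v x * (Xi x - XN x))| <=
    9 * E * \int[leb]_(x in `[0, 1]) `|v x|.
Proof.
move=> vg ort.
have c0 : sqrt2 * eps != 0 by rewrite mulf_neq0 ?gt_eqF// sqrt2_gt0.
have [X' aX] := @abs_cont_sech2 R 0 1 (h0 ord0 i') eps ltr01.
have [Y' aY] := @abs_cont_sech2 R 0 1 (h0 ord0 ord_max) eps ltr01.
have aXY := abs_contD aX (abs_contZ (-1) aY).
have iv := abs_cont_integrable ler01 vg.
have mrem : measurable_fun `[(0 : R), 1] rem.
  apply: measurable_funD.
    apply: measurable_funB; first exact: (abs_cont_measurable ler01 aX).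
    exact: (abs_cont_measurable ler01 aY).
  by apply: measurable_funM => //; exact: uxi_i_measurable.
have ivr : integrable_on 0 1 (fun x => v x * rem x) := integrable_bounded_mul mrem rem_bound iv.
have ivX : integrable_on 0 1 (fun x => v x * (Xi x - XN x)).
  have := abs_cont_mul_integrable ler01 aXY iv.
  by under [X in EFin \o X]eq_fun do rewrite mulN1r.
have -> : \int[leb]_(x in `[0, 1]) (v x * (Xi x - XN x)) =
    \int[leb]_(x in `[0, 1]) (v x * rem x).
  pose k := (-1) ^+ i / (sqrt2 * eps).
  have ss : (-1) ^+ i * (-1) ^+ i = 1 :> R by rewrite -expr2 sqrr_sign.
  have uE x : v x * uxi_i beta eps p xi i x = k * (v x * rem x - v x * (Xi x - XN x)).
    have -> : k * (v x * rem x - v x * (Xi x - XN x)) =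
       ((-1) ^+ i * (-1) ^+ i) * (v x * uxi_i beta eps p xi i x) * (sqrt2 * eps / (sqrt2 * eps)).
      by rewrite /rem /k; ring.
    by rewrite ss divff// mul1r mulr1.
  move: ort; rewrite /ip01; under eq_Rintegral do rewrite uE.
  rewrite RintegralZl//; last exact: integrable_onB.
  rewrite RintegralB// => /eqP; rewrite mulf_eq0 => /orP[|].
    by rewrite /k mulf_eq0 signr_eq0 invr_eq0 (negPf c0).
  by rewrite subr_eq0 => /eqP.
apply: (le_trans (le_normr_Rintegral _ ivr)) => //.
rewrite -RintegralZl//; last exact: integrable_norm.
apply: le_Rintegral => //.
- exact: integrable_norm.
- by apply: integrable_onZ; exact: integrable_norm.
- move=> x /=; rewrite in_itv/= => /rem_bound rb.
  by rewrite normrM mulrC ler_wpM2r.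
Qed.

End Constraint.

Lemma norm_transfer (R : realFieldType) (a b c d e : R) : `|a - b| <= e ->
  `|c - d| <= e -> `|b - d| <= 9 * e -> `|a - c| <= 11 * e.
Proof.
move=> t1 t2 t3; rewrite (_ : a - c = (a - b) - (c - d) + (b - d)); last by ring.
apply: (le_trans (ler_normD _ _)).
have := ler_normB (a - b) (c - d); lra.
Qed.

(** * Projections on a piece compared with projections on [0,1] *)

Section Assembly.
Variable R : realType.
Variables (N : nat) (kappa0 eps E : R) (h : 'rV[R]_N.+1) (v g : R -> R).
Hypothesis eps0 : 0 < eps.
Hypothesis Oh : InOmega kappa0 eps h.
Hypothesis HE : forall y : R, 1 / (2 * rho kappa0 eps) <= `|y| -> sech2 y <= E.
Hypothesis vg : abs_cont 0 1 v g.

Let m := midpoint h.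
Let A := \int[leb]_(x in `[0, 1]) `|v x|.
Let X j x := sech2 ((x - hext h j.+1) / eps).

Let m0 : m 0 = 0. Proof. exact: midpoint0. Qed.
Let mN : m N.+1 = 1. Proof. exact: midpointS. Qed.

Let mS j : (j <= N)%N -> m j <= m j.+1.
Proof. by move=> jN; have [a b] := midpoint_lt eps0 Oh jN; exact: ltW (lt_trans a b). Qed.

Let sub_int j F : (j <= N)%N -> integrable_on 0 1 F -> integrable_on (m j) (m j.+1) F.
Proof.
move=> jN; apply: integrable_sub.
  have H : m j <= m j <= m j.+1 by rewrite lexx mS.
  by have /andP[] := sub01 eps0 Oh jN H.
have H : m j <= m j.+1 <= m j.+1 by rewrite lexx mS.
by have /andP[] := sub01 eps0 Oh jN H.
Qed.

Let split_sum F : integrable_on 0 1 F ->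
  \int[leb]_(x in `[0, 1]) F x = \sum_(j < N.+1) \int[leb]_(x in `[m j, m j.+1]) F x.
Proof.
by move=> Fi; have := @Rintegral_partition R m N.+1 F; rewrite m0 mN; apply.
Qed.

Let iv : integrable_on 0 1 v. Proof. exact: (abs_cont_integrable ler01 vg). Qed.

Lemma integrable_mul_layer (y : R) : integrable_on 0 1 (fun x => v x * sech2 ((x - y) / eps)).
Proof.
have [X' aX] := @abs_cont_sech2 R 0 1 y eps ltr01.
exact: (abs_cont_mul_integrable ler01 aX iv).
Qed.

Lemma layer_tail j : (j <= N)%N ->
  `|\int[leb]_(x in `[m j, m j.+1]) (v x * X j x) - \int[leb]_(x in `[0, 1]) (v x * X j x)|
    <= E * A.
Proof.
move=> jN; have ivX : integrable_on 0 1 (fun x => v x * X j x) by exact: integrable_mul_layer.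
have iav := integrable_norm iv.
pose j' : 'I_N.+1 := Ordinal (jN : (j < N.+1)%N).
rewrite (split_sum ivX) (bigD1 j')//= opprD addrA subrr add0r normrN.
have AE : A = \sum_(k < N.+1) \int[leb]_(x in `[m k, m k.+1]) `|v x|.
  exact: (split_sum iav).
have E0 : 0 <= E.
  by have [a _] := sech2_midpoint eps0 Oh HE jN; apply: le_trans a; rewrite ltW// sech2_gt0.
apply: (@le_trans _ _ (\sum_(k < N.+1 | k != j') (E * \int[leb]_(x in `[m k, m k.+1]) `|v x|))).
  apply: (le_trans (ler_norm_sum _ _ _)); apply: ler_sum => k kj.
  have kN : (k <= N)%N by rewrite -ltnS.
  have ik := sub_int kN ivX.
  apply: (le_trans (le_normr_Rintegral _ ik)) => //.
  have iak : integrable_on (m k) (m k.+1) (fun x => `|v x|) := sub_int kN iav.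
  rewrite -RintegralZl//; apply: le_Rintegral => //.
  - exact: integrable_norm.
  - exact: integrable_onZ.
  - move=> x /=; rewrite in_itv/= => xk.
    rewrite normrM mulrC ler_wpM2r// ger0_norm; last by rewrite ltW// sech2_gt0.
    apply: (sech2_other eps0 Oh HE kN jN) => //.
    by rewrite eq_sym; move: kj; rewrite -val_eqE.
rewrite AE mulr_sumr [leRHS](bigD1 j')//= lerDr mulr_ge0//.
by apply: Rintegral_ge0.
Qed.

Lemma layer_projection_close j : (j <= N)%N ->
  `|\int[leb]_(x in `[0, 1]) (v x * (X j x - X N x))| <= 9 * E * A ->
  `|\int[leb]_(x in `[m j, m j.+1]) (v x * X j x) -
    \int[leb]_(x in `[m N, m N.+1]) (v x * X N x)| <= 11 * E * A.
Proof.
move=> jN.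
have iXj : integrable_on 0 1 (fun x => v x * X j x) by exact: integrable_mul_layer.
have iXN : integrable_on 0 1 (fun x => v x * X N x) by exact: integrable_mul_layer.
under eq_Rintegral do rewrite mulrBr.
rewrite RintegralB//.
rewrite -!mulrA => close.
exact: norm_transfer (layer_tail jN) (layer_tail (leqnn N)) close.
Qed.

End Assembly.

Lemma H1_01_abs_cont (R : realType) (v g : R -> R) : H1_01 v g ->
  abs_cont 0 1 v g /\ integrable_on 0 1 (fun x => g x ^+ 2).
Proof.
move=> [[mv v2] [[mg g2] vE]]; split => //; split => //.
have i1 : integrable_on 0 1 (fun=> 1 : R).
  exact: (abs_cont_integrable ler01 (abs_cont_cst _ _ 1)).
apply: (le_integrable _ _ _ (integrable_onD i1 g2)) => //.
  exact/measurable_EFinP.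
move=> x _ /=; rewrite lee_fin (ger0_norm (_ : 0 <= 1 + g x ^+ 2)); last first.
  by rewrite addr_ge0// sqr_ge0.
rewrite -[g x ^+ 2]real_normK ?num_real//.
by have := sqr_ge0 (`|g x| - 1 / 2); lra.
Qed.

Lemma uh_f'_integrable (R : realType) (N : nat) (eps M : R)
  (beta : R -> 'rV[R]_N.+1 -> R -> R) (h : 'rV[R]_N.+1) (v g : R -> R) :
  abs_cont 0 1 v g -> measurable_fun `[(0 : R), 1] (uh beta eps h) ->
  (forall x, 0 <= x <= 1 -> `|beta eps h x| <= M) ->
  integrable_on 0 1 (fun x => f' (uh beta eps h x) * v x ^+ 2).
Proof.
move=> vg mu_ bM.
have iv2 := abs_cont_integrable ler01 (abs_contM ler01 vg vg).
have mf : measurable_fun `[(0 : R), 1] (fun x => f' (uh beta eps h x)).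
  rewrite /f'; apply: measurable_funB => //; apply: measurable_funM => //.
  exact: measurable_funX.
have := integrable_bounded_mul (M := 3 * (N.+1%:R + M) ^+ 2 + 1) mf _ iv2.
have bound x : 0 <= x <= 1 -> `|f' (uh beta eps h x)| <= 3 * (N.+1%:R + M) ^+ 2 + 1.
  move=> x01; have ub : `|uh beta eps h x| <= N.+1%:R + M.
    apply: (le_trans (ler_normD _ _)); apply: lerD; last exact: bM.
    apply: (le_trans (ler_norm_sum _ _ _)).
    rewrite -[N.+1%:R]mulr1 -(sum_ord_cst N.+1 (1 : R)); apply: ler_sum => j _.
    rewrite normrM normrX normrN1 expr1n mul1r ler_norml.
    by have /andP[/ltW -> /ltW ->] := U_bounds ((x - h ord0 j) / eps).
  have u2 : uh beta eps h x ^+ 2 <= (N.+1%:R + M) ^+ 2.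
    rewrite -[uh _ _ _ _ ^+ 2]real_normK ?num_real// lerXn2r ?nnegrE//.
    exact: le_trans ub.
  rewrite /f'; apply: (le_trans (ler_normB _ _)); rewrite normr1 lerD2r.
  rewrite normrM (ger0_norm (sqr_ge0 _)) ger0_norm//.
  exact: ler_wpM2l.
move=> /(_ bound) H.
by apply: (eq_integrable _ _ _ _ H) => // x _ /=; congr EFin; rewrite expr2 mulrC.
Qed.

(** * Choice of the constants and conclusion *)

(** [B = 20 (N+2) E] serves as the common error: it must dominate [9 (N+2) E] from [f'_uh_ge] and
    [11 E] from [layer_projection_close], and yet satisfy [(N+1) B <= eps^2 / 1000]. *)
Lemma small_constants (R : realFieldType) (n1 n2 E eps : R) : 1 <= n2 -> n1 <= n2 ->
  0 <= E -> 20 * 1000 * (n2 * n2 * E) <= eps ^+ 2 -> 0 < eps <= 1 / 100 * (1 / 1000) ->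
  [/\ n2 * E <= 1, E <= 1 / 10, 11 * E <= 20 * n2 * E,
    n1 * (20 * n2 * E) <= eps ^+ 2 / 1000 & 9 * (n2 * E) <= 20 * n2 * E].
Proof.
move=> n2_1 n12 E0 sE /andP[e0 e1].
have h1 : E <= n2 * E by rewrite ler_peMl.
have n2E0 : 0 <= n2 * E by lra.
have h2 : n2 * E <= n2 * (n2 * E) by rewrite ler_peMl.
have h3 : n1 * (n2 * E) <= n2 * (n2 * E) by apply: ler_wpM2r.
have h4 : eps ^+ 2 <= 1 by rewrite exprn_ile1//; lra.
by split; lra.
Qed.

Lemma spectral_gap (R : realType) (N : nat) (kappa0 eps E mass : R)
  (beta : R -> 'rV[R]_N.+1 -> R -> R) (p : 'rV[R]_N -> R) (xi : 'rV[R]_N)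
  (v g : R -> R) : let h0 := hxi p xi in
  (1 <= N)%N -> 0 < eps <= 1 / 100 * (1 / 1000) -> 0 <= E ->
  20 * 1000 * (N.+2%:R * N.+2%:R * E) <= eps ^+ 2 ->
  (forall y : R, 1 / (2 * rho kappa0 eps) <= `|y| -> sech2 y <= E) ->
  InOmega kappa0 eps h0 -> differentiable p xi ->
  (forall h x, derivable (beta eps h) x 1) ->
  (forall h x, InOmega kappa0 eps h -> differentiable (fun h' => beta eps h' x) h) ->
  (forall x, 0 <= x <= 1 -> `|beta eps h0 x - ((-1) ^+ N - 1) / 2| <= E) ->
  (forall h x (j : 'I_N.+1), InOmega kappa0 eps h -> 0 <= x <= 1 ->
    `|'D_(delta_mx ord0 j) (fun h' => beta eps h' x) h| <= E) ->
  (forall h, InOmega kappa0 eps h ->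
    (\int[leb]_(x in `[0, 1]) uh beta eps h x = mass <->
     h ord0 ord_max = p (xipart h))) ->
  abs_cont 0 1 v g -> integrable_on 0 1 (fun x => g x ^+ 2) ->
  \int[leb]_(x in `[0, 1]) v x = 0 ->
  (forall i : 'I_N, ip01 v (uxi_i beta eps p xi i) = 0) ->
  eps * (27 / 10 * \int[leb]_(x in `[0, 1]) (v x ^+ 2)) <=
  eps ^+ 2 * \int[leb]_(x in `[0, 1]) (g x ^+ 2)
  + \int[leb]_(x in `[0, 1]) (f' (uh beta eps h0 x) * v x ^+ 2).
Proof.
move=> h0 N1 eps_bounds E0 smallE HE Oxi dp beta_x beta_h bound0 boundh mass_iff vg g2 v0 orth.
have n2_1 : (1 : R) <= N.+2%:R by rewrite ler1n.
have n12 : (N.+1%:R : R) <= N.+2%:R by rewrite ler_nat.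
have [c1 c2 c3 c4 c5] := small_constants n2_1 n12 E0 smallE eps_bounds.
have E01 : 0 <= E <= 1 / 10 by rewrite E0 c2.
have /andP[eps0 eps_small] := eps_bounds.
have eps1 : eps <= 1 by apply: (le_trans eps_small); clear; lra.
have c6 : E <= 20 * N.+2%:R * E by apply: le_trans c3; rewrite ler_peMl// ler1n.
move: c3 c4 c5 c6; set B := 20 * N.+2%:R * E => c3 c4 c5 c6.
have B0 : 0 <= B by apply: le_trans c6.
have u_meas : measurable_fun `[(0 : R), 1] (uh beta eps h0).
  by apply/measurable_EFinP; exact: (measurable_int _ (uh_integrable beta_x h0)).
have bM x : 0 <= x <= 1 -> `|beta eps h0 x| <= 1 + E.
  move=> /bound0 b1.
  rewrite -[beta eps h0 x](subrK (((-1) ^+ N - 1) / 2)) [1 + E]addrC.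
  apply: (le_trans (ler_normD _ _)); apply: lerD => //.
  clear; rewrite -signr_odd; case: (odd N); rewrite ?expr1 ?expr0 ler_norml.
    by apply/andP; split; lra.
  by apply/andP; split; lra.
have iu := uh_f'_integrable vg u_meas bM.
pose A := \int[leb]_(x in `[0, 1]) `|v x|.
have A0 : 0 <= A by apply: Rintegral_ge0 => x _; exact: normr_ge0.
have proj j : (j <= N)%N ->
    `|\int[leb]_(x in `[midpoint h0 j, midpoint h0 j.+1])
         (v x * sech2 ((x - hext h0 j.+1) / eps)) -
      \int[leb]_(x in `[midpoint h0 N, midpoint h0 N.+1])
         (v x * sech2 ((x - hext h0 N.+1) / eps))| <= B * A.
  rewrite leq_eqVlt => /predU1P[->|jN]; first by rewrite subrr normr0 mulr_ge0.
  have H := orthogonality eps0 E01 Oxi dp beta_x beta_h boundh mass_iff HE eps1 vg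
    (orth (Ordinal jN)).
  have jE : h0 ord0 (lift ord_max (Ordinal jN)) = hext h0 j.+1 by rewrite -hext_ord lift_max.
  have NE : h0 ord0 ord_max = hext h0 N.+1 by rewrite -hext_ord.
  rewrite -/h0 jE NE in H.
  apply: le_trans (layer_projection_close eps0 Oxi HE vg (ltnW jN) H) _.
  exact: ler_wpM2r.
apply: (@coercive R N eps B (fun j => hext h0 j.+1) (midpoint h0)) => //.
- exact: midpoint0.
- exact: midpointS.
- by move=> j jN; exact: (midpoint_lt eps0 Oxi jN).
- move=> j jN; have [a b] := sech2_midpoint eps0 Oxi HE jN.
  by split; [exact: (le_trans a c6)|exact: (le_trans b c6)].
- move=> j jN x xj; apply: le_trans (f'_uh_ge eps0 Oxi HE bound0 c1 jN xj).
  by rewrite lerD2l lerN2.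
Qed.

Theorem theorem4p4 (R : realType) (N : nat) (kappa0 lambda0 mu : R)
  (beta : R -> 'rV[R]_N.+1 -> R -> R) (hN1 : R -> 'rV[R]_N -> R) :
  (1 <= N)%N -> 0 < kappa0 < 1 ->
  0 < lambda0 -> lambda0_prop lambda0 ->
  -1 < mu < 1 ->
  (* standing assumptions on the construction of M and of h_{N+1}, for
     all sufficiently small eps, with O(exp) = O(exp(-c / rho_eps)) *)
  (exists eps0 Cb cb : R, [/\ 0 < eps0, 0 < Cb, 0 < cb &
    forall eps, 0 < eps < eps0 ->
    [/\ (* beta is smooth (C^1 in x and differentiable in h) *)
        (forall h x, derivable (beta eps h) x 1),
        (forall h x, InOmega kappa0 eps h ->
           differentiable (fun h' => beta eps h' x) h),
        (* u^h(0) = -1 and Neumann boundary conditions *)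
        (forall h, InOmega kappa0 eps h ->
           [/\ uh beta eps h 0 = -1,
               derive1 (uh beta eps h) 0 = 0 &
               derive1 (uh beta eps h) 1 = 0]),
        (* beta_N = ((-1)^N - 1)/2 + O(exp), also for derivatives *)
        (forall h x, InOmega kappa0 eps h -> 0 <= x <= 1 ->
           [/\ `|beta eps h x - ((-1) ^+ N - 1) / 2|
                  <= Cb * expR (- cb / rho kappa0 eps),
               `|derive1 (beta eps h) x| <= Cb * expR (- cb / rho kappa0 eps) &
               forall j : 'I_N.+1,
                 `|derive (fun h' => beta eps h' x) h (delta_mx ord0 j)|
                   <= Cb * expR (- cb / rho kappa0 eps)]) &
        (* h_{N+1} : u^h in M_mu iff h = (xi, h_{N+1}(xi)) in Omega *)
        (forall h, InOmega kappa0 eps h ->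
           (\int[lebesgue_measure]_(x in `[0, 1]) uh beta eps h x = mu <->
            h ord0 ord_max = hN1 eps (xipart h))) /\
        (forall xi, InOmega kappa0 eps (hxi (hN1 eps) xi) ->
           differentiable (hN1 eps) xi)]]) ->
  exists C c eps1 : R, [/\ 0 < C, 0 < c, 0 < eps1 &
    forall eps, 0 < eps < eps1 ->
    forall (xi : 'rV[R]_N),
      InOmega kappa0 eps (hxi (hN1 eps) xi) ->
      \int[lebesgue_measure]_(x in `[0, 1]) uxi beta eps (hN1 eps) xi x = mu ->
    forall v g : R -> R, H1_01 v g ->
      \int[lebesgue_measure]_(x in `[0, 1]) v x = 0 ->
      (forall i : 'I_N, ip01 v (uxi_i beta eps (hN1 eps) xi i) = 0) ->
      QL eps (uxi beta eps (hN1 eps) xi) v g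
        <= (- lambda0 * eps + C * expR (- c / rho kappa0 eps)) * nrm2_01 v].

Proof.
move=> N1 /andP[k0 _] l0 lp _ [ep0 [Cb [cb [ep00 Cb0 cb0 HYP]]]].
have l27 := lambda0_le lp.
(* A single error [K * exp (- c' / rho)] is to dominate both the layer tails, with prefactor 4 and
   rate [1/2] from [sech2_le] at the threshold [1 / (2 rho)], and the errors of [beta], with
   prefactor [Cb] and rate [cb]. *)
pose c' := Num.min (1 / 2) cb.
have c'0 : 0 < c' by rewrite lt_min cb0 andbT; lra.
have c'1 : c' <= 1 / 2 by rewrite ge_min lexx.
have c'2 : c' <= cb by rewrite ge_min lexx orbT.
have [K K4 KC] : exists2 K, 4 <= K & Cb <= K by exists (4 + Cb); lra.
have K0 : 0 < K by lra.
have nn0 : 0 < (N.+2%:R * N.+2%:R : R) by rewrite mulr_gt0// ltr0n.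
have K'0 : 0 < 20 * 1000 * (N.+2%:R * N.+2%:R * K).
  by apply: mulr_gt0; [lra|exact: mulr_gt0].
(* The power 2 matches the requirement that [(N+1) B] be at most [eps^2 / 1000]. *)
have [e1 e10 small] := exp_small 2 k0 c'0 K'0.
(* The strict margin in the constants has already absorbed every exponential error, so any positive
   prefactor and rate would do here. *)
exists 1, 1, (Num.min ep0 (Num.min e1 (1 / 100 * (1 / 1000)))); split.
- exact: ltr01.
- exact: ltr01.
- by rewrite !lt_min ep00 e10/=; lra.
move=> eps /andP[eps0]; rewrite !lt_min => /andP[eps_ep0 /andP[eps_e1 eps_small]].
move=> xi Oxi mass v g /H1_01_abs_cont[vg g2] v0 orth.
have [beta_x beta_h _ beta_b [mass_iff dp]] := HYP eps (introT andP (conj eps0 eps_ep0)).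
have r0 : 0 < rho kappa0 eps by exact: powR_gt0.
pose E := K * expR (- c' / rho kappa0 eps).
have expE (c1 C1 : R) : 0 <= C1 -> C1 <= K -> c' <= c1 ->
    C1 * expR (- c1 / rho kappa0 eps) <= E.
  move=> C10 CK cc; apply: ler_pM => //; rewrite ?expR_ge0//.
  by rewrite ler_expR ler_wpM2r ?invr_ge0 ?(ltW r0)// lerN2.
have HE (y : R) : 1 / (2 * rho kappa0 eps) <= `|y| -> sech2 y <= E.
  move=> /sech2_le /le_trans; apply.
  rewrite (_ : - (1 / (2 * rho kappa0 eps)) = - (1 / 2) / rho kappa0 eps); last first.
    by field; rewrite gt_eqF.
  by apply: expE.
have bE : Cb * expR (- cb / rho kappa0 eps) <= E by apply: expE => //; exact: ltW.
have gap : eps * (27 / 10 * \int[leb]_(x in `[0, 1]) (v x ^+ 2)) <=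
    eps ^+ 2 * \int[leb]_(x in `[0, 1]) (g x ^+ 2)
    + \int[leb]_(x in `[0, 1]) (f' (uh beta eps (hxi (hN1 eps) xi) x) * v x ^+ 2).
  apply: (@spectral_gap R N kappa0 eps E mu beta (hN1 eps) xi v g) => //.
  - by rewrite eps0 ltW.
  - by rewrite mulr_ge0 ?expR_ge0// ltW.
  - by have := small eps (introT andP (conj eps0 eps_e1)); rewrite /E !mulrA.
  - exact: dp.
  - by move=> x x01; have [b1 _ _] := beta_b _ x Oxi x01; exact: le_trans bE.
  - by move=> h x j Oh x01; have [_ _ b3] := beta_b h x Oh x01; exact: le_trans bE.
have -> : nrm2_01 v = \int[leb]_(x in `[0, 1]) (v x ^+ 2).
  by rewrite /nrm2_01 /ip01; apply: eq_Rintegral => x _; rewrite expr2.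
have V0 : 0 <= \int[leb]_(x in `[0, 1]) (v x ^+ 2).
  by apply: Rintegral_ge0 => x _; exact: sqr_ge0.
have lV := ler_wpM2r V0 (ler_wpM2l (ltW eps0) l27).
have eV := mulr_ge0 (expR_ge0 (- 1 / rho kappa0 eps)) V0.
rewrite /QL mulrDl mul1r mulNr mulNr -opprD.
apply: (@le_trans _ _ (- (lambda0 * eps * \int[leb]_(x in `[0, 1]) (v x ^+ 2)))).
  by rewrite lerN2; apply: le_trans gap; rewrite mulrA [lambda0 * eps]mulrC.
by rewrite (mulNr (lambda0 * eps)) lerDl.
Qed.
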